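(* The spectrum $\sigma(L_0)$ of the operator $L_0(\theta)$ is simple and $$\sigma(L_0)=\{\lambda_n^3(0,\theta):n\in\mathbb{Z}\},$$ where $\{\lambda_n(0,\theta)\}$ are the real zeros of the characteristic function $\Delta_\theta(0,\lambda)$. Eigenfunctions of $L_0(\theta)$ corresponding to $\lambda=\lambda_n(0,\theta)$ are $$\psi_n(0,\lambda,x)=\frac1{a_n(\lambda)}\left\{\frac{s_2(i\lambda x)}{(i\lambda)^2}\cdot\frac{s_1(i\lambda l)}{i\lambda}-\frac{s_1(i\lambda x)}{i\lambda}\cdot\frac{s_2(i\lambda l)}{(i\lambda)^2}\right\}\quad(\lambda=\lambda_n(0,\theta)),$$ where the numbers $a_n(\lambda)>0$ are found from the condition $\|\psi_n(0,\lambda,\cdot)\|_{L^2(0,l)}=1$; moreover $\psi_n(0,\lambda\zeta_2,x)=\psi_n(0,\lambda,x)$.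
   Context: Let $\zeta_1=1$, $\zeta_2=\frac12(-1+i\sqrt3)$, $\zeta_3=\frac12(-1-i\sqrt3)$ and $s_p(z)=\frac13\sum_{k=1}^3\zeta_k^{-p}e^{z\zeta_k}$ ($p=0,1,2$). Let $0<l<\infty$ and $\theta\in\mathbb{T}=\{z\in\mathbb{C}:|z|=1\}$. $L_0(\theta)$ is the self-adjoint operator in $L^2(0,l)$, $(L_0(\theta)y)(x)=iy'''(x)$, with domain $\{y\in W_2^3(0,l):y(0)=0,\ y'(l)=\theta y'(0),\ y(l)=0\}$. Its characteristic function is $$\Delta_\theta(0,\lambda)=-\frac1{(i\lambda)^2}[\theta s_2(i\lambda l)+s_2(-i\lambda l)],$$ an entire function of $\lambda$. Quotients such as $s_1(i\lambda x)/(i\lambda)$ and $s_2(i\lambda x)/(i\lambda)^2$ are understood by continuity at $\lambda=0$ (the value $\lambda=0$ is a zero of $\Delta_\theta(0,\cdot)$ only for $\theta=-1$). *)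

(* Defs.v *)
From HB Require Import structures.
From mathcomp Require Import all_boot all_order all_algebra.
From mathcomp Require Import complex.
From mathcomp Require Import all_classical all_reals all_analysis.

Set Implicit Arguments.
Unset Strict Implicit.
Unset Printing Implicit Defensive.

Import Order.TTheory GRing.Theory Num.Theory.
Import numFieldNormedType.Exports.

Local Open Scope classical_set_scope.
Local Open Scope ring_scope.
Local Open Scope complex_scope.

Definition expC (R : realType) (z : R[i]) : R[i] :=
  (expR (complex.Re z))%:C * (cos (complex.Im z) +i* sin (complex.Im z)).

Definition zeta1 (R : realType) : R[i] := 1.
Definition zeta2 (R : realType) : R[i] := (-1 + 'i%C * (Num.sqrt 3)%:C) / 2.
Definition zeta3 (R : realType) : R[i] := (-1 - 'i%C * (Num.sqrt 3)%:C) / 2.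

Definition s (R : realType) (p : nat) (z : R[i]) : R[i] :=
  3^-1 * \sum_(w <- [:: zeta1 R; zeta2 R; zeta3 R]) w ^- p * expC (z * w).

(* s_1(z x) / z and s_2(z x) / z^2.  Since s_p(w) = w^p/p! + O(w^(p+3)), their
   continuous extensions at z = 0 are x and x^2/2. *)
Definition s1_quot (R : realType) (z : R[i]) (x : R) : R[i] :=
  if z == 0 then x%:C else s 1 (z * x%:C) / z.

Definition s2_quot (R : realType) (z : R[i]) (x : R) : R[i] :=
  if z == 0 then x%:C ^+ 2 / 2 else s 2 (z * x%:C) / z ^+ 2.

(* The value at lambda = 0 is again the continuous extension. *)
Definition Delta (R : realType) (l : R) (theta lambda : R[i]) : R[i] :=
  if lambda == 0 then - ((theta + 1) * l%:C ^+ 2 / 2)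
  else - (('i%C * lambda) ^- 2 *
          (theta * s 2 ('i%C * lambda * l%:C) + s 2 (- ('i%C * lambda * l%:C)))).

Definition real_zeros (R : realType) (l : R) (theta : R[i]) : set R :=
  [set t | Delta l theta t%:C = 0].

(* Elements of L^2(0,l) are represented by functions R -> R[i], of which only
   the restriction to ]0,l[, up to a.e. equality, matters. *)
Definition ae_eq_on (R : realType) (l : R) (f g : R -> R[i]) : Prop :=
  {ae (@lebesgue_measure R), forall x, `]0, l[%classic x -> f x = g x}.

Definition sq_integral (R : realType) (l : R) (f : R -> R[i]) : \bar R :=
  (\int[@lebesgue_measure R]_(x in `]0%R, l[) ((Normc.normc (f x)) ^+ 2)%:E)%E.

Definition L2 (R : realType) (l : R) (f : R -> R[i]) : Prop :=
  [/\ measurable_fun `]0, l[ (fun x => complex.Re (f x)),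
      measurable_fun `]0, l[ (fun x => complex.Im (f x)) &
      (sq_integral l f < +oo)%E].

Definition L2norm (R : realType) (l : R) (f : R -> R[i]) : R :=
  Num.sqrt (fine (sq_integral l f)).

(* y is absolutely continuous on [0,l] with derivative g, i.e. y is an
   indefinite Lebesgue integral of the integrable function g. *)
Definition abs_cont_deriv (R : realType) (l : R) (y g : R -> R[i]) : Prop :=
  let mu := @lebesgue_measure R in
  [/\ mu.-integrable `[0, l] (fun x => (complex.Re (g x))%:E),
      mu.-integrable `[0, l] (fun x => (complex.Im (g x))%:E) &
      forall x, 0 <= x <= l ->
        y x = y 0 + (Rintegral mu `[0, x] (fun t => complex.Re (g t))
                     +i* Rintegral mu `[0, x] (fun t => complex.Im (g t)))].

(* y belongs to the Sobolev space W_2^3(0,l), with y', y'', y''' equal to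
   y1, y2, y3.  On [0,l] the functions y1 and y2 are continuous and determined
   by y, so that boundary values such as y1 0 and y1 l make sense; y3 is
   determined almost everywhere. *)
Definition W23 (R : realType) (l : R) (y y1 y2 y3 : R -> R[i]) : Prop :=
  [/\ abs_cont_deriv l y y1, abs_cont_deriv l y1 y2,
      abs_cont_deriv l y2 y3 & L2 l y3].

(* An operator A in L^2(0,l) is given by its graph: A y h means that y is in
   the domain of A and that A maps y to h. *)
Definition operator (R : realType) := (R -> R[i]) -> (R -> R[i]) -> Prop.

Definition L0 (R : realType) (l : R) (theta : R[i]) : operator R :=
  fun y h => exists y1 y2 y3 : R -> R[i],
    [/\ W23 l y y1 y2 y3, y 0 = 0, y1 l = theta * y1 0, y l = 0 &
        forall x, h x = 'i%C * y3 x].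

(* A - mu is a bijection from the domain of A onto L^2(0,l), with bounded
   inverse. *)
Definition regular_point (R : realType) (l : R) (A : operator R) (mu : R[i]) :
    Prop :=
  [/\ forall y h, A y h -> ae_eq_on l h (fun x => mu * y x) ->
        ae_eq_on l y (fun=> 0),
      forall f, L2 l f -> exists y h,
        A y h /\ ae_eq_on l (fun x => h x - mu * y x) f &
      exists C : R, forall y h, A y h ->
        L2norm l y <= C * L2norm l (fun x => h x - mu * y x)].

Definition spectrum (R : realType) (l : R) (A : operator R) : set R[i] :=
  [set mu | ~ regular_point l A mu].

Definition eigenfunction (R : realType) (l : R) (A : operator R) (mu : R[i])
    (y : R -> R[i]) : Prop :=
  ~ ae_eq_on l y (fun=> 0) /\
  exists h, A y h /\ ae_eq_on l h (fun x => mu * y x).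

Definition simple_eigenvalue (R : realType) (l : R) (A : operator R)
    (mu : R[i]) : Prop :=
  exists2 y, eigenfunction l A mu y &
    forall u, eigenfunction l A mu u ->
      exists c : R[i], ae_eq_on l u (fun x => c * y x).

Definition simple_spectrum (R : realType) (l : R) (A : operator R) : Prop :=
  forall mu, spectrum l A mu -> simple_eigenvalue l A mu.

Definition psi_num (R : realType) (l : R) (lambda : R[i]) (x : R) : R[i] :=
  s2_quot ('i%C * lambda) x * s1_quot ('i%C * lambda) l
  - s1_quot ('i%C * lambda) x * s2_quot ('i%C * lambda) l.

Definition psi_with (R : realType) (l a : R) (lambda : R[i]) (x : R) : R[i] :=
  (a%:C)^-1 * psi_num l lambda x.

Definition normalizing (R : realType) (l : R) (lambda : R[i]) (a : R) : Prop :=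
  0 < a /\ L2norm l (psi_with l a lambda) = 1.

Definition norming_const (R : realType) (l : R) (lambda : R[i]) : R :=
  L2norm l (psi_num l lambda).

Definition psi (R : realType) (l : R) (lambda : R[i]) : R -> R[i] :=
  psi_with l (norming_const l lambda) lambda.

Definition enumerates (R : realType) (lam : int -> R) (Z : set R) : Prop :=
  injective lam /\ range lam = Z.

(* Main.v *)
(** Put z = i lambda and k = z^3.  For every z, including 0, the functions
    s_0(z x), s_1(z x)/z and s_2(z x)/z^2 are the fundamental system of
    y''' = k y at x = 0.  If y lies in W_2^3, y(0) = 0 and g = y''' - k y, then
    variation of constants, applied to (y, y', y'' - int_0^x g) so that only
    classical derivatives occur, expresses y and y' through y'(0), one more
    constant and int g.  The two boundary conditions involving l become a linear
    system whose determinant is - Delta(lambda).  Hence lambda^3 is a regular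
    point if Delta(lambda) <> 0 and an eigenvalue otherwise; in the latter case
    Lagrange's identity shows that lambda^3 is real, so that lambda may be taken
    real.

    Writing theta = c^2, the nonzero real zeros of Delta are those of
    Re (c s_2(i lambda l)).  There are infinitely many of them because
    3 s_2(i x) equals zeta_3 e^(sqrt 3 x / 2) e^(- i x / 2) up to an error at
    most 2 for x >= 0, and countably many because the phase of s_2(i x) is
    strictly monotone on each side of 0, which makes them simple. *)

Require Import Defs.
From mathcomp Require Import all_boot all_order all_algebra ring lra.
From mathcomp Require Import complex.
From mathcomp Require Import all_classical all_reals all_analysis measurable_realfun.

Set Implicit Arguments.
Unset Strict Implicit.
Unset Printing Implicit Defensive.

Import Order.TTheory GRing.Theory Num.Theory.
Import numFieldNormedType.Exports.
Local Open Scope classical_set_scope.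
Local Open Scope ring_scope.
Local Open Scope complex_scope.

(** * Componentwise calculus of complex-valued functions *)

(** One mechanism, isolated in [monotone_kernel], carries three steps: if the derivative of a real
    function is a nonzero real multiple of |y|^2 and the function agrees at two points, then y = 0
    between them. For a solution y of the boundary value problem it makes lambda^3 real. For y =
    s_1(z x)/z with lambda real it shows that s_2(z l)/z^2 is nonzero; then y(l) = 0 fixes the ratio
    of the two free coefficients, which gives simplicity and keeps psi_n from vanishing identically.
    For y = s_2 at lambda = 1 it gives the monotone phase. The determinant meets Delta through s_2(-
    z l), because the fundamental matrix at - l is the inverse of the one at l. The right-hand side
    g is only defined almost everywhere, so it enters through its primitive alone, whose sup norm is
    bounded by the L^2 norm of g. The resulting sup bound on y yields both injectivity and the
    bounded inverse. *)

(* Limits in R[i] are taken componentwise: R[i] is a normed space over itself,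
   not over R. *)
Definition cder (R : realType) (f : R -> R[i]) (x : R) (d : R[i]) : Prop :=
  is_derive x 1 (fun t => complex.Re (f t)) (complex.Re d) /\
  is_derive x 1 (fun t => complex.Im (f t)) (complex.Im d).

Definition ccont (R : realType) (f : R -> R[i]) : Prop :=
  continuous (fun t => complex.Re (f t)) /\
  continuous (fun t => complex.Im (f t)).

Section ComplexCalculus.
Variable R : realType.
Implicit Types (f g : R -> R[i]) (x : R) (z d e : R[i]).

Lemma ReD z d : complex.Re (z + d) = complex.Re z + complex.Re d.
Proof. by case: z d => [a b] [c e]. Qed.
Lemma ImD z d : complex.Im (z + d) = complex.Im z + complex.Im d.
Proof. by case: z d => [a b] [c e]. Qed.
Lemma ReN z : complex.Re (- z) = - complex.Re z.
Proof. by case: z. Qed.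
Lemma ImN z : complex.Im (- z) = - complex.Im z.
Proof. by case: z. Qed.
Lemma ReM z d :
  complex.Re (z * d) = complex.Re z * complex.Re d - complex.Im z * complex.Im d.
Proof. by case: z d => [a b] [c e]. Qed.
Lemma ImM z d :
  complex.Im (z * d) = complex.Re z * complex.Im d + complex.Im z * complex.Re d.
Proof. by case: z d => [a b] [c e]. Qed.
Lemma ReJ z : complex.Re (conjc z) = complex.Re z. Proof. by case: z. Qed.
Lemma ImJ z : complex.Im (conjc z) = - complex.Im z. Proof. by case: z. Qed.

Definition ReImE := (ReD, ImD, ReN, ImN, ReM, ImM, ReJ, ImJ).

Lemma cplxP z d :
  complex.Re z = complex.Re d -> complex.Im z = complex.Im d -> z = d.
Proof. by case: z d => [a b] [c e] /= -> ->. Qed.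

Lemma is_derive_ext (f g : R -> R) x (a b : R) :
  is_derive x 1 f a -> f =1 g -> a = b -> is_derive x 1 g b.
Proof. by move=> fa /funext <- <-. Qed.

Lemma cder_ext f g x d e : cder f x d -> f =1 g -> d = e -> cder g x e.
Proof. by move=> fd /funext <- <-. Qed.

Lemma cder_cst d x : cder (fun=> d) x 0.
Proof. by split; apply: is_derive_cst. Qed.

Lemma cderD f g x d e : cder f x d -> cder g x e ->
  cder (fun t => f t + g t) x (d + e).
Proof.
move=> [f1 f2] [g1 g2]; split.
- by apply: (is_derive_ext (is_deriveD f1 g1)) => [t|]; rewrite /= ?ReImE.
- by apply: (is_derive_ext (is_deriveD f2 g2)) => [t|]; rewrite /= ?ReImE.
Qed.

Lemma cderM f g x d e : cder f x d -> cder g x e ->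
  cder (fun t => f t * g t) x (d * g x + f x * e).
Proof.
move=> [f1 f2] [g1 g2]; split.
- apply: (is_derive_ext (is_deriveB (is_deriveM f1 g1) (is_deriveM f2 g2))).
  + by move=> t; rewrite /= ReImE.
  + rewrite !ReImE /GRing.scale /=; ring.
- apply: (is_derive_ext (is_deriveD (is_deriveM f1 g2) (is_deriveM f2 g1))).
  + by move=> t; rewrite /= ReImE.
  + rewrite !ReImE /GRing.scale /=; ring.
Qed.

Lemma cderZ f z x d : cder f x d -> cder (fun t => z * f t) x (z * d).
Proof.
move=> fd; apply: (cder_ext (cderM (cder_cst z x) fd)) => //.
by rewrite mul0r add0r.
Qed.

Lemma cderN f x d : cder f x d -> cder (fun t => - f t) x (- d).
Proof. by move=> /(cderZ (-1)) fd; apply: (cder_ext fd) => [t|]; rewrite mulN1r. Qed.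

Lemma cderB f g x d e : cder f x d -> cder g x e ->
  cder (fun t => f t - g t) x (d - e).
Proof. by move=> fd /cderN ge; exact: cderD. Qed.

Lemma cderJ f x d : cder f x d -> cder (fun t => conjc (f t)) x (conjc d).
Proof.
move=> [f1 f2]; split.
- by apply: (is_derive_ext f1) => [t|]; rewrite ReImE.
- by apply: (is_derive_ext (is_deriveN f2)) => [t|]; rewrite /= ReImE.
Qed.

Lemma cder_Nx f x d : cder f (- x) d -> cder (fun t => f (- t)) x (- d).
Proof.
have oppx : is_derive x 1 (-%R : R -> R) (-1).
  exact: (is_deriveN (is_derive_id x 1)).
move=> [f1 f2]; split.
- apply: (is_derive_ext (is_derive1_comp f1 oppx)) => //.
  by rewrite ReImE mulrN1.
- apply: (is_derive_ext (is_derive1_comp f2 oppx)) => //.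
  by rewrite ReImE mulrN1.
Qed.

Lemma is_derive_continuous (f : R -> R) x (a : R) :
  is_derive x 1 f a -> {for x, continuous f}.
Proof.
by move=> [fx _]; apply/differentiable_continuous/derivable1_diffP.
Qed.

Lemma cder_cont f g : (forall x, cder f x (g x)) -> ccont f.
Proof. by move=> fg; split=> x; have [] := fg x => *; exact: is_derive_continuous. Qed.

Lemma is_derive_within (f df : R -> R) (a b : R) :
  (forall x, a <= x <= b -> is_derive x 1 f (df x)) ->
  {within `[a, b], continuous f}.
Proof.
move=> fd; apply: continuous_in_subspaceT => x /[!inE]/= xab.
by apply: is_derive_continuous (fd x _); rewrite in_itv/= in xab.
Qed.

Lemma is_derive_0_cst_on (f : R -> R) (a b : R) : a <= b ->
  (forall x, a <= x <= b -> is_derive x 1 f (0 : R)) -> f a = f b.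
Proof.
rewrite le_eqVlt => /predU1P[->//|ab] fd.
have [] := @MVT R f (fun=> 0) a b ab.
- by move=> x xab; apply: fd; rewrite !(itvP xab).
- exact: (@is_derive_within f (fun=> 0)).
by move=> c _ /eqP; rewrite mul0r subr_eq0 => /eqP.
Qed.

Lemma cder_0_cst_on f (a b : R) : a <= b ->
  (forall x, a <= x <= b -> cder f x 0) -> f a = f b.
Proof.
move=> ab fd; apply: cplxP.
- by apply: (is_derive_0_cst_on (f := fun t => complex.Re (f t)) ab) => x /fd[].
- by apply: (is_derive_0_cst_on (f := fun t => complex.Im (f t)) ab) => x /fd[].
Qed.

Lemma cder_0_cst f x : (forall x, cder f x 0) -> f x = f 0.
Proof.
move=> fd; have [x0|x0] := leP 0 x; last by apply: cder_0_cst_on => //; exact: ltW.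
by apply/esym; apply: cder_0_cst_on.
Qed.

Lemma cder_expC z x :
  cder (fun t => expC (z * t%:C)) x (z * expC (z * x%:C)).
Proof.
have lin (a : R) : is_derive x 1 (fun t : R => a * t) a.
  apply: (is_derive_ext (is_deriveZ a (is_derive_id x 1))) => //.
  by rewrite /GRing.scale /= mulr1.
case: z => a b.
have He := is_derive1_comp (is_derive_expR (a * x)) (lin a).
have Hc := is_derive1_comp (is_derive_cos (b * x)) (lin b).
have Hs := is_derive1_comp (is_derive_sin (b * x)) (lin b).
split.
- apply: (is_derive_ext (is_deriveM He Hc)) => [t|].
    by rewrite /expC /= !(mul0r, mulr0, subr0, addr0, add0r).
  rewrite /expC /GRing.scale /= !(mul0r, mulr0, subr0, addr0, add0r); ring.
- apply: (is_derive_ext (is_deriveM He Hs)) => [t|].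
    by rewrite /expC /= !(mul0r, mulr0, subr0, addr0, add0r).
  rewrite /expC /GRing.scale /= !(mul0r, mulr0, subr0, addr0, add0r); ring.
Qed.

End ComplexCalculus.

(** * The fundamental system *)

(** The third member of the family of [s1_quot] and [s2_quot]: the power divided out is [z ^+ 0], so
    [z = 0] needs no separate case. *)
Definition s0_quot (R : realType) (z : R[i]) (x : R) : R[i] := s 0 (z * x%:C).

Section FundamentalSystem.
Variable R : realType.
Implicit Types (z w : R[i]) (x : R).

Local Notation z2 := (zeta2 R).
Local Notation z3 := (zeta3 R).

(** * Cube roots of unity and the three exponential sums *)

Lemma zeta2E : z2 = (- 1 / 2) +i* (Num.sqrt 3 / 2).
Proof.
apply: (mulIf (x := 2)); first by rewrite pnatr_eq0.
by rewrite /zeta2 mulfVK ?pnatr_eq0//; apply: cplxP; simpl; lra.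
Qed.

Lemma zeta3E : z3 = conjc z2.
Proof.
apply: (mulIf (x := 2)); first by rewrite pnatr_eq0.
by rewrite zeta2E /zeta3 mulfVK ?pnatr_eq0//; apply: cplxP; simpl; lra.
Qed.

Lemma zeta_sqr : z2 ^+ 2 = z3.
Proof.
rewrite zeta3E zeta2E expr2; have := @sqr_sqrtr R 3 (ler0n R 3).
by rewrite expr2 => h; apply: cplxP; simpl; nra.
Qed.

Lemma zeta_mul : z2 * z3 = 1.
Proof.
rewrite zeta3E zeta2E; have := @sqr_sqrtr R 3 (ler0n R 3).
by rewrite expr2 => h; apply: cplxP; simpl; nra.
Qed.

Lemma zeta_sum : 1 + z2 + z3 = 0.
Proof. by rewrite zeta3E zeta2E; apply: cplxP; simpl; lra. Qed.

Lemma zeta3_sqr : z3 ^+ 2 = z2.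
Proof. by rewrite -zeta_sqr -exprM (exprD _ 3 1) exprS zeta_sqr zeta_mul mul1r expr1. Qed.

Lemma zeta2_neq0 : z2 != 0.
Proof. by apply: contra_eq_neq zeta_mul => ->; rewrite mul0r eq_sym oner_eq0. Qed.

Lemma zeta2V : z2^-1 = z3.
Proof. by apply: (mulfI zeta2_neq0); rewrite mulfV ?zeta2_neq0// zeta_mul. Qed.

Lemma zeta3V : z3^-1 = z2.
Proof. by rewrite -zeta2V invrK. Qed.

Lemma zeta_exp3 : z2 ^+ 3 = 1.
Proof. by rewrite exprS zeta_sqr zeta_mul. Qed.

Lemma s0E z : s 0 z = 3^-1 * (expC z + expC (z * z2) + expC (z * z3)).
Proof.
rewrite /s !big_cons big_nil /zeta1 !(expr0, invr1, mul1r, mulr1, addr0).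
by rewrite addrA.
Qed.

Lemma s1E z : s 1 z = 3^-1 * (expC z + z3 * expC (z * z2) + z2 * expC (z * z3)).
Proof.
rewrite /s !big_cons big_nil /zeta1 !(expr1, invr1, mul1r, mulr1, addr0).
by rewrite zeta2V zeta3V addrA.
Qed.

Lemma s2E z : s 2 z = 3^-1 * (expC z + z2 * expC (z * z2) + z3 * expC (z * z3)).
Proof.
rewrite /s !big_cons big_nil /zeta1 !(expr1n, invr1, mul1r, mulr1, addr0).
by rewrite zeta3_sqr zeta_sqr zeta2V zeta3V addrA.
Qed.

Lemma conjcD z w : conjc (z + w) = conjc z + conjc w.
Proof. by rewrite rmorphD. Qed.

Lemma conjcM z w : conjc (z * w) = conjc z * conjc w.
Proof. by rewrite rmorphM. Qed.

Lemma expC0 : expC (0 : R[i]) = 1.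
Proof. by rewrite /expC /= expR0 cos0 sin0 mul1r. Qed.

Lemma expCJ z : expC (conjc z) = conjc (expC z).
Proof.
by case: z => a b; rewrite /expC /= cosN sinN; apply: cplxP; simpl; ring.
Qed.

(** Conjugation exchanges [z2] and [z3], both in the exponents and in the coefficients. On the
    imaginary axis this reads s_2(-w) = conj(s_2(w)), which makes [Delta] essentially real at real
    arguments. *)
Lemma s2_conj z : s 2 (conjc z) = conjc (s 2 z).
Proof.
have zJ : conjc z2 = z3 by rewrite zeta3E.
have zJ' : conjc z3 = z2 by rewrite zeta3E conjcK.
have -> : conjc (s 2 z) = 3^-1 * (expC (conjc z)
    + z3 * expC (conjc z * z3) + z2 * expC (conjc z * z2)).
  by rewrite s2E conjcM !conjcD (conjcM z2) (conjcM z3) -!expCJ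
    (conjcM _ z2) (conjcM _ z3) conjc_inv conjc_nat zJ zJ'.
by rewrite s2E; ring.
Qed.

Lemma cder_expC_zeta z z' x :
  cder (fun t => expC (z * t%:C * z')) x (z * z' * expC (z * x%:C * z')).
Proof.
apply: (cder_ext (cder_expC (z * z') x)) => [t|].
  by rewrite (mulrAC z z' t%:C).
by rewrite (mulrAC z z' x%:C).
Qed.

Lemma cder_s0 z x : cder (fun t => s 0 (z * t%:C)) x (z * s 2 (z * x%:C)).
Proof.
apply: (cder_ext (cderZ 3^-1 (cderD (cderD (cder_expC z x)
  (cder_expC_zeta z z2 x)) (cder_expC_zeta z z3 x)))) => [t|]; rewrite ?s0E ?s2E //.
ring.
Qed.

Lemma cder_s1 z x : cder (fun t => s 1 (z * t%:C)) x (z * s 0 (z * x%:C)).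
Proof.
apply: (cder_ext (cderZ 3^-1 (cderD (cderD (cder_expC z x)
  (cderZ z3 (cder_expC_zeta z z2 x))) (cderZ z2 (cder_expC_zeta z z3 x)))))
  => [t|]; rewrite ?s0E ?s1E //.
rewrite [z3 * _]mulrA [z3 * _]mulrCA [z3 * z2]mulrC [z2 * (_ * _)]mulrA.
by rewrite [z2 * (_ * _)]mulrCA zeta_mul; ring.
Qed.

Lemma cder_s2 z x : cder (fun t => s 2 (z * t%:C)) x (z * s 1 (z * x%:C)).
Proof.
apply: (cder_ext (cderZ 3^-1 (cderD (cderD (cder_expC z x)
  (cderZ z2 (cder_expC_zeta z z2 x))) (cderZ z3 (cder_expC_zeta z z3 x)))))
  => [t|]; rewrite ?s2E ?s1E //.
rewrite [z2 * _]mulrA [z2 * _]mulrCA -expr2 zeta_sqr [z3 * (_ * _)]mulrA.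
by rewrite [z3 * (_ * _)]mulrCA -expr2 zeta3_sqr; ring.
Qed.

Lemma cder_id x : cder (fun t : R => t%:C) x 1.
Proof. by split; [exact: is_derive_id|exact: is_derive_cst]. Qed.

Lemma cder_s0_quot z x : cder (s0_quot z) x (z ^+ 3 * s2_quot z x).
Proof.
apply: (cder_ext (cder_s0 z x)) => //; rewrite /s2_quot.
have [->|z0] := eqVneq z 0; first by rewrite expr0n !mul0r.
by field.
Qed.




Lemma s0_0 : s 0 (0 : R[i]) = 1.
Proof. by rewrite s0E !mul0r expC0; field. Qed.

Lemma s1_0 : s 1 (0 : R[i]) = 0.
Proof.
rewrite s1E !mul0r expC0 !mulr1 addrAC; apply/eqP.
by rewrite mulf_eq0 zeta_sum eqxx orbT.
Qed.

Lemma s2_0 : s 2 (0 : R[i]) = 0.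
Proof. by rewrite s2E !mul0r expC0 !mulr1 zeta_sum mulr0. Qed.

Lemma cder_s1_quot z x : cder (s1_quot z) x (s0_quot z x).
Proof.
rewrite /s0_quot /s1_quot; have [->|z0] := eqVneq z 0.
  by apply: (cder_ext (cder_id x)); rewrite // mul0r s0_0.
apply: (cder_ext (cderZ z^-1 (cder_s1 z x))) => [t|]; first by rewrite mulrC.
by rewrite mulKf.
Qed.

Lemma cder_s2_quot z x : cder (s2_quot z) x (s1_quot z x).
Proof.
rewrite /s2_quot /s1_quot; have [_|z0] := eqVneq z 0.
  apply: (cder_ext (cderZ 2^-1 (cderM (cder_id x) (cder_id x)))) => [t|].
    by rewrite mulrC expr2.
  by field.
apply: (cder_ext (cderZ (z ^+ 2)^-1 (cder_s2 z x))) => [t|]; first by rewrite mulrC.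
by field.
Qed.

Lemma s0_quot_at0 z : s0_quot z 0 = 1.
Proof. by rewrite /s0_quot mulr0 s0_0. Qed.

Lemma s1_quot_at0 z : s1_quot z 0 = 0.
Proof. by rewrite /s1_quot mulr0 s1_0 mul0r; case: ifP. Qed.

Lemma s2_quot_at0 z : s2_quot z 0 = 0.
Proof. by rewrite /s2_quot mulr0 s2_0 expr2 !mul0r; case: ifP. Qed.

Local Notation S0 z x := (s0_quot z x).
Local Notation S1 z x := (s1_quot z x).
Local Notation S2 z x := (s2_quot z x).

(** With k = z^3, let M(x) be the fundamental matrix with rows (S0, S1, S2), (k S2, S0, S1), (k S1,
    k S2, S0). This lemma and the next two are the first row of M(x) M(-x) = 1; the other rows
    repeat them up to a factor k. Each left side has derivative 0 and is evaluated at 0. *)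
Lemma fund_inv0 z x :
  S0 z x * S0 z (- x) + z ^+ 3 * S1 z x * S2 z (- x)
    + z ^+ 3 * S2 z x * S1 z (- x) = 1.
Proof.
pose k := z ^+ 3.
rewrite -[RHS](_ : S0 z 0 * S0 z (- 0) + k * S1 z 0 * S2 z (- 0)
    + k * S2 z 0 * S1 z (- 0) = 1); last first.
  by rewrite oppr0 s0_quot_at0 s1_quot_at0 s2_quot_at0 !mulr0 mulr1 !addr0.
apply: (cder_0_cst (f := fun x => S0 z x * S0 z (- x)
  + k * S1 z x * S2 z (- x) + k * S2 z x * S1 z (- x))) => {}x.
apply: (cder_ext (cderD (cderD
  (cderM (cder_s0_quot z x) (cder_Nx (cder_s0_quot z (- x))))
  (cderM (cderZ k (cder_s1_quot z x)) (cder_Nx (cder_s2_quot z (- x)))))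
  (cderM (cderZ k (cder_s2_quot z x)) (cder_Nx (cder_s1_quot z (- x)))))) => //.
rewrite /k; ring.
Qed.

Lemma fund_inv1 z x :
  S1 z x * S0 z (- x) + S0 z x * S1 z (- x)
    + z ^+ 3 * S2 z x * S2 z (- x) = 0.
Proof.
pose k := z ^+ 3.
rewrite -[RHS](_ : S1 z 0 * S0 z (- 0) + S0 z 0 * S1 z (- 0)
    + k * S2 z 0 * S2 z (- 0) = 0); last first.
  by rewrite oppr0 s1_quot_at0 s2_quot_at0 !mulr0 mul0r !addr0.
apply: (cder_0_cst (f := fun x => S1 z x * S0 z (- x)
  + S0 z x * S1 z (- x) + k * S2 z x * S2 z (- x))) => {}x.
apply: (cder_ext (cderD (cderD
  (cderM (cder_s1_quot z x) (cder_Nx (cder_s0_quot z (- x))))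
  (cderM (cder_s0_quot z x) (cder_Nx (cder_s1_quot z (- x)))))
  (cderM (cderZ k (cder_s2_quot z x)) (cder_Nx (cder_s2_quot z (- x)))))) => //.
rewrite /k; ring.
Qed.

Lemma fund_inv2 z x :
  S2 z x * S0 z (- x) + S1 z x * S1 z (- x) + S0 z x * S2 z (- x) = 0.
Proof.
rewrite -[RHS](_ : S2 z 0 * S0 z (- 0) + S1 z 0 * S1 z (- 0)
    + S0 z 0 * S2 z (- 0) = 0); last first.
  by rewrite oppr0 s1_quot_at0 s2_quot_at0 !mulr0 mul0r !addr0.
apply: (cder_0_cst (f := fun x => S2 z x * S0 z (- x)
  + S1 z x * S1 z (- x) + S0 z x * S2 z (- x))) => {}x.
apply: (cder_ext (cderD (cderD
  (cderM (cder_s2_quot z x) (cder_Nx (cder_s0_quot z (- x))))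
  (cderM (cder_s1_quot z x) (cder_Nx (cder_s1_quot z (- x)))))
  (cderM (cder_s0_quot z x) (cder_Nx (cder_s2_quot z (- x)))))) => //.
ring.
Qed.

(** The left side is the determinant of the fundamental matrix. It is constant by Liouville's
    formula, the companion system of y''' = k y being trace free. *)
Lemma fund_det z x :
  S0 z x ^+ 3 + z ^+ 3 * S1 z x ^+ 3 + z ^+ 6 * S2 z x ^+ 3
    - 3 * z ^+ 3 * S0 z x * S1 z x * S2 z x = 1.
Proof.
pose F x := S0 z x * (S0 z x * S0 z x) + z ^+ 3 * (S1 z x * (S1 z x * S1 z x))
  + z ^+ 6 * (S2 z x * (S2 z x * S2 z x))
  - 3 * z ^+ 3 * (S0 z x * (S1 z x * S2 z x)).
transitivity (F x); first by rewrite /F; ring.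
have -> : 1 = F 0.
  by rewrite /F s0_quot_at0 s1_quot_at0 s2_quot_at0 !(mulr0, mulr1, addr0, subr0).
apply: cder_0_cst => {}x.
have d0 := cder_s0_quot z x; have d1 := cder_s1_quot z x; have d2 := cder_s2_quot z x.
apply: (cder_ext (cderB (cderD (cderD (cderM d0 (cderM d0 d0))
  (cderZ (z ^+ 3) (cderM d1 (cderM d1 d1))))
  (cderZ (z ^+ 6) (cderM d2 (cderM d2 d2))))
  (cderZ (3 * z ^+ 3) (cderM d0 (cderM d1 d2))))) => //.
ring.
Qed.

(* Both sides are the same entry of the inverse of the fundamental matrix, which
   has determinant 1 and whose inverse at x is its value at -x. *)
Lemma s2_quotN z x : S2 z (- x) = S1 z x ^+ 2 - S0 z x * S2 z x.
Proof.
have e0 := fund_inv0 z x; have e1 := fund_inv1 z x; have e2 := fund_inv2 z x.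
rewrite -[LHS]mulr1 -(fund_det z x).
(* Cramer's rule for S2(-x): [fund_inv0], [fund_inv1] and [fund_inv2] are linear equations in the
   values at -x, and the three multipliers are the cofactors of the column of S2(-x). *)
have -> : S1 z x ^+ 2 - S0 z x * S2 z x =
  (S1 z x ^+ 2 - S0 z x * S2 z x)
  * (S0 z x * S0 z (- x) + z ^+ 3 * S1 z x * S2 z (- x)
    + z ^+ 3 * S2 z x * S1 z (- x))
  + (z ^+ 3 * S2 z x ^+ 2 - S0 z x * S1 z x)
    * (S1 z x * S0 z (- x) + S0 z x * S1 z (- x) + z ^+ 3 * S2 z x * S2 z (- x))
  + (S0 z x ^+ 2 - z ^+ 3 * S1 z x * S2 z x)
    * (S2 z x * S0 z (- x) + S1 z x * S1 z (- x) + S0 z x * S2 z (- x)).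
  by rewrite e0 e1 e2 !mulr0 mulr1 !addr0.
ring.
Qed.

(** [Delta] equals - (theta S2(l) + S2(-l)), including the conventional value at 0, where S2(l) =
    S2(-l) = l^2/2; [s2_quotN] then removes the reflected argument. *)
Lemma Delta_fund (l : R) (theta lambda : R[i]) :
  let z := 'i%C * lambda in
  Delta l theta lambda =
    - (S1 z l ^+ 2 - S0 z l * S2 z l + theta * S2 z l).
Proof.
move=> z; rewrite -s2_quotN /Delta /s2_quot mulf_eq0.
have -> : 'i%C == 0 :> R[i] = false by rewrite eq_complex /= oner_eq0 andbF.
rewrite /=; have [l0|l0] := eqVneq lambda 0.
  by rewrite rmorphN /=; field.
rewrite -/z rmorphN /= mulrN; field.
by rewrite /z mulf_neq0// eq_complex /= oner_eq0 andbF.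
Qed.

(** * Invariance under multiplication of [z] by [zeta2] *)

Lemma mul_zeta22 z : z * z2 * z2 = z * z3.
Proof. by rewrite -(mulrA z z2 z2) -(expr2 z2) zeta_sqr. Qed.

Lemma mul_zeta23 z : z * z2 * z3 = z.
Proof. by rewrite -(mulrA z z2 z3) zeta_mul mulr1. Qed.

Lemma s0_zeta z : s 0 (z * z2) = s 0 z.
Proof. by rewrite !s0E mul_zeta22 mul_zeta23; ring. Qed.

Lemma s1_zeta z : s 1 (z * z2) = z2 * s 1 z.
Proof.
rewrite !s1E mul_zeta22 mul_zeta23.
have h : z2 * (z2 * expC (z * z3)) = z3 * expC (z * z3).
  by rewrite (mulrA z2) -(expr2 z2) zeta_sqr.
have h' : z2 * (z3 * expC (z * z2)) = expC (z * z2).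
  by rewrite (mulrA z2) zeta_mul mul1r.
by rewrite [RHS]mulrCA !(mulrDr z2) h h'; ring.
Qed.

Lemma s2_zeta z : s 2 (z * z2) = z2 ^+ 2 * s 2 z.
Proof.
rewrite !s2E mul_zeta22 mul_zeta23 zeta_sqr.
have h : z3 * (z3 * expC (z * z3)) = z2 * expC (z * z3).
  by rewrite (mulrA z3) -(expr2 z3) zeta3_sqr.
have h' : z3 * (z2 * expC (z * z2)) = expC (z * z2).
  by rewrite (mulrA z3) (mulrC z3) zeta_mul mul1r.
by rewrite [RHS]mulrCA !(mulrDr z3) h h'; ring.
Qed.

(** The rotation multiplies s_p by the p-th power of [z2], and the division by z^p cancels that
    factor. *)
Lemma s1_quot_zeta z x : S1 (z * z2) x = S1 z x.
Proof.
rewrite /s1_quot mulf_eq0 (negbTE zeta2_neq0) orbF; case: eqP => // /eqP z0.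
rewrite (mulrAC z z2 x%:C) s1_zeta; field; apply/andP; split=> //; exact: zeta2_neq0.
Qed.

Lemma s2_quot_zeta z x : S2 (z * z2) x = S2 z x.
Proof.
rewrite /s2_quot mulf_eq0 (negbTE zeta2_neq0) orbF; case: eqP => // /eqP z0.
rewrite (mulrAC z z2 x%:C) s2_zeta; field; apply/andP; split=> //; exact: zeta2_neq0.
Qed.

Lemma psi_zeta (l : R) (lambda : R[i]) x :
  psi l (lambda * z2) x = psi l lambda x.
Proof.
have num : psi_num l (lambda * z2) = psi_num l lambda.
  by apply/funext => y; rewrite /psi_num mulrA !s1_quot_zeta !s2_quot_zeta.
by rewrite /psi /psi_with /norming_const num.
Qed.

End FundamentalSystem.

(** * Primitives of real functions *)

Section RealIntegrals.
Variable R : realType.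
Local Notation mu := (@lebesgue_measure R).

Lemma continuous_integrable (a b : R) (h : R -> R) :
  {within `[a, b], continuous h} -> mu.-integrable `[a, b] (EFin \o h).
Proof.
by move=> hc; apply: continuous_compact_integrable => //; exact: segment_compact.
Qed.

(** Cutting g off outside [0, l] gives an indefinite integral that is continuous on the whole line.
    Later primitives of it are then differentiable from both sides at 0 and at l. *)
Lemma primitive_extension (l : R) (g : R -> R) :
  mu.-integrable `[0, l] (EFin \o g) ->
  exists2 G : R -> R, continuous G &
    forall x, 0 <= x <= l -> G x = Rintegral mu `[0, x] g.
Proof.
move=> gi; pose h := g \_ `[0, l].
have hi : mu.-integrable setT (EFin \o h).
  by rewrite /h -restrict_EFin; apply/integrable_restrict => //; rewrite setTI.
have h0 t : ~~ (0 <= t <= l) -> h t = 0.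
  by move=> tl; rewrite /h patchE mem_setE in_itv/= (negPf tl).
have hE t : 0 <= t <= l -> h t = g t.
  by move=> tl; rewrite /h patchE mem_setE in_itv/= tl.
clearbody h; pose G x := Rintegral mu `]-oo, x] h.
(* The integrand vanishes to the left of 0, so the lower limit may be any negative a. Continuity at
   a point then follows on a compact interval around it. *)
have GE a x : a < 0 -> G x = Rintegral mu `[a, x] h.
  move=> a0; rewrite /G Rintegral_mkcond [RHS]Rintegral_mkcond.
  apply: eq_Rintegral => t _; rewrite !patchE !mem_setE !in_itv/=.
  case: (leP a t) => //= ta; case: ifP => // _; apply: h0.
  by rewrite negb_and -ltNge (lt_trans ta a0).
exists G.
  move=> x0; pose a := - `|x0| - 1; pose b := `|x0| + 1.
  have a0 : a < 0 by rewrite /a; have := normr_ge0 x0; lra.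
  have x0a : a < x0 by rewrite /a; have := lerNnormlW (lexx `|x0|); lra.
  have x0b : x0 < b by rewrite /b; have := ler_norm x0; lra.
  have ab : a < b by exact: lt_trans x0b.
  have hi' : mu.-integrable `[a, b] (EFin \o h) by apply: integrableS hi.
  have := parameterized_integral_continuous (ltW ab) hi'.
  move=> /(continuous_within_itvP _ ab)[+ _ _] => /(_ x0).
  rewrite (_ : (fun x => _) = G); last by apply/funext => x; rewrite (GE a x).
  by apply; rewrite in_itv/= x0a x0b.
move=> x /andP[x0 xl]; rewrite /G Rintegral_mkcond [RHS]Rintegral_mkcond.
apply: eq_Rintegral => t _; rewrite !patchE !mem_setE !in_itv/=.
have [tx|] := leP t x; last by rewrite andbF.
rewrite andbT; have [t0|t0] := leP 0 t; first by rewrite hE// t0 (le_trans tx).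
by rewrite h0// leNgt t0.
Qed.

(** The primitive starts at b and is differentiable only to the right of b; the gap between a and b
    ensures continuity of h at the starting point. *)
Lemma ex_primitive (a b : R) (h : R -> R) : a < b ->
  (forall x, a < x -> {for x, continuous h}) ->
  exists H : R -> R, forall x, b < x -> is_derive x 1 H (h x).
Proof.
move=> ab hc; exists (fun x => Rintegral mu `[b, x] h) => x bx.
have hi : mu.-integrable `[b, x + 1] (EFin \o h).
  apply: continuous_integrable; apply: continuous_in_subspaceT => t.
  rewrite inE/= in_itv/= => /andP[bt _]; apply: hc; exact: lt_le_trans bt.
have xx1 : x < x + 1 by rewrite ltrDl.
have [] := continuous_FTC1_closed xx1 hi bx (hc x (lt_trans ab bx)).
by move=> /derivableP dH; rewrite derive1E => <-.
Qed.

Lemma FTC2_on (l : R) (H h : R -> R) :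
  (forall x, 0 <= x <= l -> is_derive x 1 H (h x)) ->
  {within `[0, l], continuous h} ->
  forall x, 0 <= x <= l -> Rintegral mu `[0, x] h = H x - H 0.
Proof.
move=> Hd hc x /andP[]; rewrite le_eqVlt => /predU1P[<- _|x0 xl].
  by rewrite set_itv1 Rintegral_set1 subrr.
have sub t : t \in `]0, x[ -> 0 <= t <= l.
  by rewrite in_itv/= => /andP[t0 tx]; rewrite (ltW t0) (le_trans (ltW tx)).
have Hc : {within `[0, x], continuous H}.
  apply: (@is_derive_within R H h) => t /andP[t0 tx].
  by apply: Hd; rewrite t0 (le_trans tx).
rewrite /Rintegral (@continuous_FTC2 _ h H) //=.
- apply: continuous_subspaceW hc.
  by move=> t /=; rewrite !in_itv/= => /andP[-> tx]; rewrite (le_trans tx).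
- have /(continuous_within_itvP _ x0)[_ H0 Hx] := Hc.
  by split => // t /sub /Hd [].
- by move=> t /sub /Hd dt; rewrite derive1E derive_val.
Qed.

End RealIntegrals.

(** * Complex integrals and the space W_2^3 *)

Definition cint (R : realType) (g : R -> R[i]) (x : R) : R[i] :=
  Rintegral (@lebesgue_measure R) `[0, x] (fun t => complex.Re (g t))
  +i* Rintegral (@lebesgue_measure R) `[0, x] (fun t => complex.Im (g t)).

Definition cintegrable (R : realType) (l : R) (g : R -> R[i]) : Prop :=
  (@lebesgue_measure R).-integrable `[0, l] (fun x => (complex.Re (g x))%:E) /\
  (@lebesgue_measure R).-integrable `[0, l] (fun x => (complex.Im (g x))%:E).

Section ComplexIntegrals.
Variable R : realType.
Local Notation mu := (@lebesgue_measure R).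
Implicit Types (l x : R) (f g h : R -> R[i]) (k z : R[i]).
Local Notation normc := Normc.normc.

Lemma cder_Bx f (x y : R) d : cder f (x - y) d ->
  cder (fun t => f (x - t)) y (- d).
Proof.
have subx : is_derive y 1 (fun t : R => x - t) (-1).
  apply: (is_derive_ext (is_deriveB (is_derive_cst x y 1) (is_derive_id y 1))) => //.
  by rewrite sub0r.
move=> [f1 f2]; split.
- apply: (is_derive_ext (@is_derive1_comp R _ (fun t => x - t) y _ _ f1 subx)) => //.
  by rewrite ReImE mulrN1.
- apply: (is_derive_ext (@is_derive1_comp R _ (fun t => x - t) y _ _ f2 subx)) => //.
  by rewrite ReImE mulrN1.
Qed.

Lemma cint_eq l f g x : x <= l -> (forall t, 0 <= t <= l -> f t = g t) ->
  cint f x = cint g x.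
Proof.
move=> xl fg; rewrite /cint; congr (_ +i* _); apply: eq_Rintegral => t;
by rewrite inE/= in_itv/= => /andP[t0 tx]; rewrite fg// t0 (le_trans tx).
Qed.

Lemma cintegrableS l x g : cintegrable l g -> x <= l -> cintegrable x g.
Proof.
move=> [g1 g2] xl; split; [apply: integrableS g1 => //|apply: integrableS g2 => //];
by move=> t /=; rewrite !in_itv/= => /andP[-> tx]; rewrite (le_trans tx).
Qed.

Lemma cintegrable_eq l f g : (forall t, 0 <= t <= l -> f t = g t) ->
  cintegrable l f -> cintegrable l g.
Proof.
move=> fg [f1 f2]; split; [apply: eq_integrable f1|apply: eq_integrable f2] => //;
by move=> t; rewrite inE/= in_itv/= => /fg ->.
Qed.

Lemma cintegrableD l f g : cintegrable l f -> cintegrable l g ->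
  cintegrable l (fun t => f t + g t).
Proof.
move=> [f1 f2] [g1 g2]; split.
- by apply: eq_integrable (integrableD _ f1 g1) => // t _ /=; rewrite ReImE.
- by apply: eq_integrable (integrableD _ f2 g2) => // t _ /=; rewrite ReImE.
Qed.

Lemma cintegrableZ l k f : cintegrable l f -> cintegrable l (fun t => k * f t).
Proof.
move=> [f1 f2].
pose Z a := @integrableZl _ _ _ mu `[0, l] (measurable_itv _) a.
split.
- apply: eq_integrable (integrableD _ (Z (complex.Re k) _ f1)
    (Z (- complex.Im k) _ f2)) => // t _ /=.
  by rewrite ReImE -EFinD mulNr.
- apply: eq_integrable (integrableD _ (Z (complex.Re k) _ f2)
    (Z (complex.Im k) _ f1)) => // t _ /=.
  by rewrite ReImE -EFinD.
Qed.

Lemma cintD x f g : cintegrable x f -> cintegrable x g ->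
  cint (fun t => f t + g t) x = cint f x + cint g x.
Proof.
move=> [f1 f2] [g1 g2]; apply: cplxP => /=; rewrite -RintegralD//;
by apply: eq_Rintegral => t _; rewrite ReImE.
Qed.

Lemma cintZ x k f : cintegrable x f -> cint (fun t => k * f t) x = k * cint f x.
Proof.
move=> [f1 f2].
have Z a (u : R -> R) : mu.-integrable `[0, x] (EFin \o u) ->
    mu.-integrable `[0, x] (EFin \o (fun t => a * u t)).
  by move=> ui; exact: (@integrableZl _ _ _ mu _ (measurable_itv _) a _ ui).
apply: cplxP; rewrite ReImE /=.
- rewrite -mulNr -!RintegralZl// -RintegralD//; [|exact: Z|exact: Z].
  by apply: eq_Rintegral => t _; rewrite ReImE mulNr.
- rewrite -!RintegralZl// -RintegralD//; [|exact: Z|exact: Z].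
  by apply: eq_Rintegral => t _; rewrite ReImE.
Qed.

Lemma cint_extension l g : cintegrable l g ->
  exists2 G : R -> R[i], ccont G & forall x, 0 <= x <= l -> G x = cint g x.
Proof.
move=> [/primitive_extension[G1 G1c G1E] /primitive_extension[G2 G2c G2E]].
exists (fun x => G1 x +i* G2 x) => [|x xl]; first by split.
by rewrite G1E// G2E.
Qed.

Lemma ex_cprimitive (a b c : R) h : a < b ->
  (forall x, a < x -> {for x, continuous (fun t => complex.Re (h t))}) ->
  (forall x, a < x -> {for x, continuous (fun t => complex.Im (h t))}) ->
  exists2 H : R -> R[i], H c = 0 & forall x, b < x -> cder H x (h x).
Proof.
move=> ab /(ex_primitive ab)[H1 dH1] /(ex_primitive ab)[H2 dH2].
exists (fun x => (H1 x +i* H2 x) - (H1 c +i* H2 c)); first by rewrite subrr.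
move=> x bx; have Hx : cder (fun x => H1 x +i* H2 x) x (h x).
  by split; [exact: dH1|exact: dH2].
by apply: (cder_ext (cderB Hx (cder_cst (H1 c +i* H2 c) x))) => //; rewrite subr0.
Qed.

Definition cwithin (l : R) f : Prop :=
  {within `[0, l], continuous (fun t => complex.Re (f t))} /\
  {within `[0, l], continuous (fun t => complex.Im (f t))}.

Lemma ccont_within l f : ccont f -> cwithin l f.
Proof. by move=> [f1 f2]; split; apply: continuous_subspaceT. Qed.

Lemma cder_within l f g : (forall x, 0 <= x <= l -> cder f x (g x)) -> cwithin l f.
Proof.
move=> fg; split.
- by apply: (@is_derive_within _ _ (fun x => complex.Re (g x))) => x /fg[].
- by apply: (@is_derive_within _ _ (fun x => complex.Im (g x))) => x /fg[].
Qed.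

Lemma cwithin_integrable l f : cwithin l f -> cintegrable l f.
Proof. by move=> [f1 f2]; split; apply: continuous_integrable. Qed.

Lemma cFTC2 l H h : (forall x, 0 <= x <= l -> cder H x (h x)) -> cwithin l h ->
  forall x, 0 <= x <= l -> cint h x = H x - H 0.
Proof.
move=> Hd [h1 h2] x xl; apply: cplxP; rewrite !ReImE /=.
- by apply: (@FTC2_on _ l (fun t => complex.Re (H t))) => // t /Hd[].
- by apply: (@FTC2_on _ l (fun t => complex.Im (H t))) => // t /Hd[].
Qed.

Lemma abs_cont_derivP l y g : abs_cont_deriv l y g <->
  cintegrable l g /\ forall x, 0 <= x <= l -> y x = y 0 + cint g x.
Proof. by split=> [[? ? ?]|[[? ?] ?]]. Qed.

Lemma cder_abs_cont l y g : (forall x, 0 <= x <= l -> cder y x (g x)) ->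
  cwithin l g -> abs_cont_deriv l y g.
Proof.
move=> yd gc; apply/abs_cont_derivP; split; first exact: cwithin_integrable.
by move=> x xl; rewrite (cFTC2 yd gc xl) addrC subrK.
Qed.

(** The state (w, w1, w2) at t is transported to x by the first row of the fundamental matrix at x -
    t. The result [phi] does not depend on t; it is w(x) at t = x and the claimed formula at t =
    0. *)
Lemma fund_unique l z w w1 w2 :
  (forall x, 0 <= x <= l -> cder w x (w1 x)) ->
  (forall x, 0 <= x <= l -> cder w1 x (w2 x)) ->
  (forall x, 0 <= x <= l -> cder w2 x (z ^+ 3 * w x)) ->
  forall x, 0 <= x <= l ->
    w x = s0_quot z x * w 0 + s1_quot z x * w1 0 + s2_quot z x * w2 0.
Proof.
move=> dw dw1 dw2 x /andP[x0 xl].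
pose phi t := s0_quot z (x - t) * w t + s1_quot z (x - t) * w1 t
  + s2_quot z (x - t) * w2 t.
transitivity (phi x).
  by rewrite /phi subrr s0_quot_at0 s1_quot_at0 s2_quot_at0 mul1r !mul0r !addr0.
transitivity (phi 0); last by rewrite /phi subr0.
apply/esym; apply: cder_0_cst_on => // t /andP[t0 tx].
have tl : 0 <= t <= l by rewrite t0 (le_trans tx).
apply: (cder_ext (cderD (cderD
  (cderM (cder_Bx (cder_s0_quot z (x - t))) (dw t tl))
  (cderM (cder_Bx (cder_s1_quot z (x - t))) (dw1 t tl)))
  (cderM (cder_Bx (cder_s2_quot z (x - t))) (dw2 t tl)))) => //.
ring.
Qed.

(* The extensions Y and Y1 of y and y' beyond [0, l] have two-sided derivatives
   at the end points; y'' is split into a differentiable part W and G. *)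
Lemma W23_analysis l k y y1 y2 y3 : 0 <= l -> W23 l y y1 y2 y3 ->
  cintegrable l (fun t => y3 t - k * y t) /\
  exists Y Y1 W G : R -> R[i], [/\ ccont G,
    forall x, 0 <= x <= l -> cder Y x (Y1 x),
    forall x, 0 <= x <= l -> cder Y1 x (W x + G x),
    forall x, 0 <= x <= l -> cder W x (k * Y x) &
    forall x, 0 <= x <= l ->
      [/\ y x = Y x, y1 x = Y1 x & G x = cint (fun t => y3 t - k * y t) x] ].
Proof.
move=> l0 [/abs_cont_derivP[_ yE] /abs_cont_derivP[_ y1E]
  /abs_cont_derivP[y3i y2E] _].
have [G3 [G3r G3i] G3E] := cint_extension y3i.
pose Y2 x := y2 0 + G3 x.
have Y2r : continuous (fun t => complex.Re (Y2 t)).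
  move=> x; rewrite /Y2 (_ : (fun t => _) =
    fun t => complex.Re (y2 0) + complex.Re (G3 t)).
    by apply: continuousD; [exact: cst_continuous|exact: G3r].
  by apply/funext => t; rewrite ReImE.
have Y2i : continuous (fun t => complex.Im (Y2 t)).
  move=> x; rewrite /Y2 (_ : (fun t => _) =
    fun t => complex.Im (y2 0) + complex.Im (G3 t)).
    by apply: continuousD; [exact: cst_continuous|exact: G3i].
  by apply/funext => t; rewrite ReImE.
have y2Y x : 0 <= x <= l -> y2 x = Y2 x by move=> xl; rewrite y2E// -G3E.
have sub (a x : R) : a < 0 -> 0 <= x <= l -> a < x.
  by move=> a0 /andP[x0 _]; exact: lt_le_trans x0.
(* Each integration shrinks the half-line on which the primitive is known to be
   differentiable; it must still contain 0 in its interior at the end. *)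
have [H1 H10 dH1] := @ex_cprimitive (-3) (-2) 0 Y2 ltac:(lra)
  (fun x _ => Y2r x) (fun x _ => Y2i x).
pose Y1 x := y1 0 + H1 x.
have dY1 x : -2 < x -> cder Y1 x (Y2 x).
  by move=> /dH1 dx; apply: (cder_ext (cderD (cder_cst (y1 0) x) dx)); rewrite // add0r.
have y1Y x : 0 <= x <= l -> y1 x = Y1 x.
  move=> xl; rewrite y1E//; congr (_ + _); rewrite (cint_eq _ y2Y) ?(andP xl).2//.
  rewrite (@cFTC2 l H1 Y2 _ _ x xl) ?H10 ?subr0// => [t tl|].
    by apply: dH1; apply: sub tl; lra.
  exact: ccont_within.
have cY1r x : -2 < x -> {for x, continuous (fun t => complex.Re (Y1 t))}.
  by move=> /dY1[+ _]; exact: is_derive_continuous.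
have cY1i x : -2 < x -> {for x, continuous (fun t => complex.Im (Y1 t))}.
  by move=> /dY1[_]; exact: is_derive_continuous.
have [H0 H00 dH0] := @ex_cprimitive (-2) (-1) 0 Y1 ltac:(lra)
  cY1r cY1i.
pose Y x := y 0 + H0 x.
have dY x : -1 < x -> cder Y x (Y1 x).
  by move=> /dH0 dx; apply: (cder_ext (cderD (cder_cst (y 0) x) dx)); rewrite // add0r.
have Y1w : cwithin l Y1 by apply: cder_within => x xl; apply: dY1; apply: sub xl; lra.
have yY x : 0 <= x <= l -> y x = Y x.
  move=> xl; rewrite yE//; congr (_ + _); rewrite (cint_eq _ y1Y) ?(andP xl).2//.
  rewrite (@cFTC2 l H0 Y1 _ Y1w x xl) ?H00 ?subr0// => t tl.
  by apply: dH0; apply: sub tl; lra.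
have cYr x : -1 < x -> {for x, continuous (fun t => complex.Re (Y t))}.
  by move=> /dY[+ _]; exact: is_derive_continuous.
have cYi x : -1 < x -> {for x, continuous (fun t => complex.Im (Y t))}.
  by move=> /dY[_]; exact: is_derive_continuous.
have [Hw Hw0 dHw] := @ex_cprimitive (-1) (-1/2) 0 Y ltac:(lra)
  cYr cYi.
pose W x := y2 0 + k * Hw x.
have Yw : cwithin l Y by apply: cder_within => x xl; apply: dY; apply: sub xl; lra.
have yi : cintegrable l y.
  by apply: cintegrable_eq (cwithin_integrable Yw) => t /yY.
have gi : cintegrable l (fun t => y3 t - k * y t).
  apply: cintegrable_eq (cintegrableD y3i (cintegrableZ (- k) yi)) => t _.
  by rewrite mulNr.
split=> //; have [G Gc GE] := cint_extension gi.
exists Y, Y1, W, G; split=> //.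
- by move=> x xl; apply: dY; apply: sub xl; lra.
- move=> x xl; suff <- : Y2 x = W x + G x by apply: dY1; apply: sub xl; lra.
  rewrite -y2Y// y2E// /W -addrA; congr (_ + _); rewrite GE//.
  have xl' := (andP xl).2; have [y3x yx] := (cintegrableS y3i xl', cintegrableS yi xl').
  rewrite (_ : (fun t => y3 t - k * y t) = (fun t => y3 t + (- k) * y t)); last first.
    by apply/funext => t; rewrite mulNr.
  rewrite cintD//; last exact: cintegrableZ.
  rewrite cintZ// (cint_eq xl' yY) (@cFTC2 l Hw Y _ Yw x xl) ?Hw0; first by ring.
  by move=> t tl; apply: dHw; apply: sub tl; lra.
- move=> x xl; apply: (cder_ext (cderD (cder_cst (y2 0) x) (cderZ k (dHw x _)))) => //.
    by apply: sub xl; lra.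
  by rewrite add0r.
- by move=> x xl; rewrite yY// y1Y// GE.
Qed.

End ComplexIntegrals.

(** * Variation of constants *)

Section Resolvent.
Variable R : realType.
Local Notation mu := (@lebesgue_measure R).
Implicit Types (l x : R) (f g h : R -> R[i]) (k z : R[i]).
Local Notation normc := Normc.normc.
Local Notation S0 := s0_quot.
Local Notation S1 := s1_quot.
Local Notation S2 := s2_quot.

Lemma normc_ge0 z : 0 <= normc z.
Proof. by case: z => a b; exact: sqrtr_ge0. Qed.

Lemma normc_sqr z : normc z ^+ 2 = complex.Re z ^+ 2 + complex.Im z ^+ 2.
Proof. by case: z => a b; rewrite /= sqr_sqrtr// addr_ge0// sqr_ge0. Qed.

Lemma Re_le_normc z : `|complex.Re z| <= normc z.
Proof.
rewrite -(@ler_pXn2r _ 2)// ?nnegrE ?normc_ge0// normc_sqr.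
by rewrite real_normK ?num_real// lerDl sqr_ge0.
Qed.

Lemma Im_le_normc z : `|complex.Im z| <= normc z.
Proof.
rewrite -(@ler_pXn2r _ 2)// ?nnegrE ?normc_ge0// normc_sqr.
by rewrite real_normK ?num_real// lerDr sqr_ge0.
Qed.

Lemma normc_le_ReIm z : normc z <= `|complex.Re z| + `|complex.Im z|.
Proof.
rewrite -(@ler_pXn2r _ 2)// ?nnegrE ?normc_ge0 ?addr_ge0// normc_sqr sqrrD.
by rewrite !real_normK ?num_real// lerD2r lerDl mulrn_wge0// mulr_ge0.
Qed.

Lemma normcM z w : normc (z * w) = normc z * normc w.
Proof. exact: Normc.normcM. Qed.

Lemma normcD_le z w (a b : R) : normc z <= a -> normc w <= b -> normc (z + w) <= a + b.
Proof. by move=> za wb; apply: le_trans (le_normcD z w) (lerD za wb). Qed.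

Lemma normcM_le z w (a b : R) : normc z <= a -> normc w <= b -> normc (z * w) <= a * b.
Proof. by move=> za wb; rewrite normcM; apply: ler_pM => //; exact: normc_ge0. Qed.

Lemma ccont_bounded (a b : R) f : a <= b -> ccont f ->
  exists2 M, 0 <= M & forall x, a <= x <= b -> normc (f x) <= M.
Proof.
move=> ab [f1 f2]; pose n x := `|complex.Re (f x)| + `|complex.Im (f x)|.
have nc : continuous n.
  have n1 : continuous (fun x => `|complex.Re (f x)| : R).
    by move=> x; apply: continuous_comp; [exact: f1|exact: norm_continuous].
  have n2 : continuous (fun x => `|complex.Im (f x)| : R).
    by move=> x; apply: continuous_comp; [exact: f2|exact: norm_continuous].
  by move=> x; exact: (continuousD (n1 x) (n2 x)).
have [c _ cP] := EVT_max ab (continuous_subspaceT nc).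
exists (n c) => [|x xab]; first by rewrite addr_ge0.
by apply: le_trans (normc_le_ReIm _) _; apply: cP; rewrite in_itv.
Qed.

Lemma ccontM f g : ccont f -> ccont g -> ccont (fun t => f t * g t).
Proof.
move=> [f1 f2] [g1 g2]; split=> x.
- rewrite (_ : (fun t => _) = (fun t => complex.Re (f t)) * (fun t => complex.Re (g t))
    - (fun t => complex.Im (f t)) * (fun t => complex.Im (g t))).
    by apply: continuousB; apply: continuousM; [exact: f1|exact: g1|exact: f2|exact: g2].
  by apply/funext => t; rewrite ReImE.
- rewrite (_ : (fun t => _) = (fun t => complex.Re (f t)) * (fun t => complex.Im (g t))
    + (fun t => complex.Im (f t)) * (fun t => complex.Re (g t))).
    by apply: continuousD; apply: continuousM; [exact: f1|exact: g2|exact: f2|exact: g1].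
  by apply/funext => t; rewrite ReImE.
Qed.

Lemma ccont_s0_quot z : ccont (S0 z).
Proof. exact: cder_cont (cder_s0_quot z). Qed.
Lemma ccont_s1_quot z : ccont (S1 z).
Proof. exact: cder_cont (cder_s1_quot z). Qed.
Lemma ccont_s2_quot z : ccont (S2 z).
Proof. exact: cder_cont (cder_s2_quot z). Qed.

Lemma ccontNx f g : (forall x, cder f x (g x)) -> ccont (fun t => f (- t)).
Proof. by move=> fg; apply: cder_cont (fun x => cder_Nx (fg (- x))). Qed.

(** The mean value theorem is applied to the real and imaginary parts separately; adding the two
    bounds produces the factor 2. *)
Lemma cder_bound l f g (B : R) : f 0 = 0 ->
  (forall x, 0 <= x <= l -> cder f x (g x)) ->
  (forall x, 0 <= x <= l -> normc (g x) <= B) ->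
  forall x, 0 <= x <= l -> normc (f x) <= 2 * l * B.
Proof.
move=> f0 fd gB x /andP[x0 xl].
have B0 : 0 <= B by apply: le_trans (gB 0 _); rewrite ?normc_ge0 ?lexx ?(le_trans x0).
have l0 : 0 <= l := le_trans x0 xl.
have real_bound (F G : R -> R) : F 0 = 0 ->
    (forall x, 0 <= x <= l -> is_derive x 1 F (G x)) ->
    (forall x, 0 <= x <= l -> `|G x| <= B) -> `|F x| <= l * B.
  move=> F0 Fd GB; move: x0; rewrite le_eqVlt => /predU1P[<-|x0].
    by rewrite F0 normr0 mulr_ge0.
  have sub t : t \in `]0, x[ -> 0 <= t <= l.
    by rewrite in_itv/= => /andP[t0 tx]; rewrite (ltW t0) (le_trans (ltW tx)).
  have [t /sub tl||c /sub cl] := @MVT R F G 0 x x0.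
  - exact: Fd.
  - apply: (@is_derive_within _ F G) => t /andP[t0 tx].
    by apply: Fd; rewrite t0 (le_trans tx).
  rewrite F0 !subr0 => ->; rewrite normrM mulrC ler_pM// ?GB//.
  by rewrite ger0_norm// ltW.
apply: le_trans (normc_le_ReIm _) _; rewrite -mulrA mulrDl mul1r lerD//.
- apply: (real_bound (fun t => complex.Re (f t)) (fun t => complex.Re (g t))).
  + by rewrite f0.
  + by move=> t /fd[].
  + by move=> t tl; exact: le_trans (Re_le_normc _) (gB _ tl).
- apply: (real_bound (fun t => complex.Im (f t)) (fun t => complex.Im (g t))).
  + by rewrite f0.
  + by move=> t /fd[].
  + by move=> t tl; exact: le_trans (Im_le_normc _) (gB _ tl).
Qed.

(* Variation of constants for y''' = z^3 y + G', with the third-order equation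
   written for (y, y', y'' - G) so that G need not be differentiable. *)
Lemma particular_solution l z : 0 <= l -> exists C : R, 0 <= C /\
  forall G, ccont G -> exists P Q V : R -> R[i],
  [/\ [/\ P 0 = 0, Q 0 = 0 & V 0 = 0],
    forall x, 0 <= x <= l -> cder P x (Q x),
    forall x, 0 <= x <= l -> cder Q x (V x + G x),
    forall x, 0 <= x <= l -> cder V x (z ^+ 3 * P x) &
    forall B, (forall x, 0 <= x <= l -> normc (G x) <= B) ->
      forall x, 0 <= x <= l -> normc (P x) <= C * B /\ normc (Q x) <= C * B ].
Proof.
move=> l0; pose k := z ^+ 3.
have Nl : - l <= l by rewrite (le_trans _ l0)// oppr_le0.
have [M0 M00 M0P] := ccont_bounded Nl (ccont_s0_quot z).
have [M1 M10 M1P] := ccont_bounded Nl (ccont_s1_quot z).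
have [M2 M20 M2P] := ccont_bounded Nl (ccont_s2_quot z).
pose M := M0 + M1 + M2.
have M_ge0 : 0 <= M by rewrite !addr_ge0.
have SM x : - l <= x <= l ->
    [/\ normc (S0 z x) <= M, normc (S1 z x) <= M & normc (S2 z x) <= M].
  move=> xl; split; [have := M0P x xl|have := M1P x xl|have := M2P x xl];
  rewrite /M; lra.
(* M bounds the fundamental system on [-l, l], where both S(x) and S(-t) are needed. By [cder_bound]
   each [A0], [A1], [A2] below is at most 2 l M B, and multiplying by S(x) gives one more M. P has
   one term with factor k and Q has two; twice 1 + |k| covers both. *)
exists (2 * (1 + normc k) * (M * (2 * l * M))); split.
  by rewrite !(mulr_ge0, addr_ge0)// normc_ge0.
move=> G Gc.
have prim S S' : (forall x, cder S x (S' x)) ->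
  exists2 A : R -> R[i], A 0 = 0 & forall x, 0 <= x <= l -> cder A x (S (- x) * G x).
  move=> /ccontNx /ccontM /(_ Gc) [SG1 SG2].
  have [A A0 dA] := @ex_cprimitive R (-2) (-1) 0 (fun t => S (- t) * G t) ltac:(lra)
    (fun x _ => SG1 x) (fun x _ => SG2 x).
  by exists A => // x /andP[x0 _]; apply: dA; apply: lt_le_trans x0; rewrite oppr_lt0.
have [A0 A00 dA0] := prim _ _ (cder_s0_quot z).
have [A1 A10 dA1] := prim _ _ (cder_s1_quot z).
have [A2 A20 dA2] := prim _ _ (cder_s2_quot z).
(* The triple (P, Q, V) satisfies the companion system with inhomogeneity (0, G, 0). It is M(x)
   applied to a primitive of M(-t) (0, G, 0), and the second column (S1, S0, k S2) of M(-t) gives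
   the vector (A1, A0, k A2). *)
pose P x := S1 z x * A0 x + S0 z x * A1 x + k * (S2 z x * A2 x).
pose Q x := S0 z x * A0 x + k * (S2 z x * A1 x) + k * (S1 z x * A2 x).
pose V x := k * (S2 z x * A0 x + S1 z x * A1 x + S0 z x * A2 x).
have i0 := fund_inv0 z; have i1 := fund_inv1 z; have i2 := fund_inv2 z.
exists P, Q, V; split.
- by split; rewrite /P /Q /V A00 A10 A20 !mulr0 !addr0 ?mulr0.
- move=> x xl; apply: (cder_ext (cderD (cderD
    (cderM (cder_s1_quot z x) (dA0 x xl)) (cderM (cder_s0_quot z x) (dA1 x xl)))
    (cderZ k (cderM (cder_s2_quot z x) (dA2 x xl))))) => //.
  rewrite /Q -[RHS]addr0 -[X in _ = _ + X](mul0r (G x)) -(i1 x) /k; ring.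
- move=> x xl; apply: (cder_ext (cderD (cderD
    (cderM (cder_s0_quot z x) (dA0 x xl)) (cderZ k (cderM (cder_s2_quot z x) (dA1 x xl))))
    (cderZ k (cderM (cder_s1_quot z x) (dA2 x xl))))) => //.
  rewrite /V -[X in _ = _ + X](mul1r (G x)) -(i0 x) /k; ring.
- move=> x xl; apply: (cder_ext (cderZ k (cderD (cderD
    (cderM (cder_s2_quot z x) (dA0 x xl)) (cderM (cder_s1_quot z x) (dA1 x xl)))
    (cderM (cder_s0_quot z x) (dA2 x xl))))) => //.
  rewrite /P -[RHS]addr0 -[X in _ = _ + X](mulr0 k) -[X in _ = _ + k * X](mul0r (G x)).
  rewrite -(i2 x) /k; ring.
- move=> B GB x xl.
  have [B0 SMN] : 0 <= B /\ (forall t, 0 <= t <= l -> - l <= - t <= l).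
    split; first by apply: le_trans (GB 0 _); rewrite ?normc_ge0 ?lexx.
    by move=> t /andP[t0 tl]; rewrite lerN2 tl /= (le_trans _ l0)// oppr_le0.
  have [Ax0 [Ax1 Ax2]] : [/\ normc (A0 x) <= 2 * l * (M * B) &
      normc (A1 x) <= 2 * l * (M * B) /\ normc (A2 x) <= 2 * l * (M * B)].
    split; [|split]; [apply: (cder_bound A00 dA0)|apply: (cder_bound A10 dA1)|
      apply: (cder_bound A20 dA2)] => // t tl;
    by have [? ? ?] := SM _ (SMN _ tl); apply: normcM_le => //; exact: GB.
  have [|SM0 SM1 SM2] := SM x.
    by move: xl => /andP[x0 ->]; rewrite (le_trans _ x0)// oppr_le0.
  pose X := M * (2 * l * (M * B)).
  have X0 : 0 <= X by rewrite !mulr_ge0.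
  have kX0 : 0 <= normc k * X by rewrite mulr_ge0// normc_ge0.
  have -> : 2 * (1 + normc k) * (M * (2 * l * M)) * B = 2 * X + 2 * (normc k * X).
    by rewrite /X; ring.
  have kk : normc k <= normc k by [].
  split; rewrite /P /Q.
  + apply: (@le_trans _ _ (X + X + normc k * X)); last by lra.
    by do !apply: normcD_le; do ?apply: normcM_le.
  + apply: (@le_trans _ _ (X + normc k * X + normc k * X)); last by lra.
    by do !apply: normcD_le; do ?apply: normcM_le.
Qed.

End Resolvent.

(** * Square integrable functions *)

Section SquareIntegrable.
Variable R : realType.
Local Notation mu := (@lebesgue_measure R).
Implicit Types (l x : R) (f g h : R -> R[i]) (k z : R[i]).
Local Notation normc := Normc.normc.

Lemma integrable_addr (i : interval R) (u v : R -> R) :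
  mu.-integrable [set` i] (EFin \o u) -> mu.-integrable [set` i] (EFin \o v) ->
  mu.-integrable [set` i] (EFin \o (fun x => u x + v x)).
Proof. by move=> ui vi; apply: eq_integrable (integrableD _ ui vi). Qed.

Lemma integrable_mulr (i : interval R) (a : R) (u : R -> R) :
  mu.-integrable [set` i] (EFin \o u) ->
  mu.-integrable [set` i] (EFin \o (fun x => a * u x)).
Proof. by move=> ui; apply: eq_integrable (integrableZl _ a ui). Qed.

Lemma integrable_oo_cc l (u : R -> R) :
  mu.-integrable `]0, l[ (EFin \o u) -> mu.-integrable `[0, l] (EFin \o u).
Proof.
move=> /integrableP[um uoo]; apply/integrableP; split.
  by apply/emeasurable_fun_itv_obnd_cbndP/emeasurable_fun_itv_bndo_bndcP.
by rewrite integral_itv_bndoo//; exact: measurableT_comp.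
Qed.

Lemma integrable_cc_oo l (u : R -> R) :
  mu.-integrable `[0, l] (EFin \o u) -> mu.-integrable `]0, l[ (EFin \o u).
Proof. by apply: integrableS => //; exact: subset_itv_oo_cc. Qed.

Lemma measurable_normc_sqr (D : set R) f : measurable D ->
  measurable_fun D (fun x => complex.Re (f x)) ->
  measurable_fun D (fun x => complex.Im (f x)) ->
  measurable_fun D (fun x => normc (f x) ^+ 2).
Proof.
move=> mD f1 f2; under eq_fun do rewrite normc_sqr.
by apply: measurable_funD; exact: measurable_funX.
Qed.

Lemma L2P l f : L2 l f <->
  [/\ measurable_fun `]0, l[ (fun x => complex.Re (f x)),
      measurable_fun `]0, l[ (fun x => complex.Im (f x)) &
      mu.-integrable `]0, l[ (fun x => (normc (f x) ^+ 2)%:E)].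
Proof.
have E : (\int[mu]_(x in `]0%R, l[) `|(normc (f x) ^+ 2)%:E|)%E = sq_integral l f.
  by apply: eq_integral => x _; rewrite gee0_abs// lee_fin sqr_ge0.
split=> -[f1 f2 fi]; split=> //.
  apply/integrableP; split; last by rewrite E.
  by apply/measurable_EFinP; exact: measurable_normc_sqr.
by move/integrableP : fi => [_]; rewrite E.
Qed.

Lemma L2_dom l f (u : R -> R) :
  measurable_fun `]0, l[ (fun x => complex.Re (f x)) ->
  measurable_fun `]0, l[ (fun x => complex.Im (f x)) ->
  mu.-integrable `]0, l[ (EFin \o u) ->
  (forall x, normc (f x) ^+ 2 <= u x) -> L2 l f.
Proof.
move=> f1 f2 ui fu; apply/L2P; split=> //; apply: le_integrable ui => //.
  by apply/measurable_EFinP; exact: measurable_normc_sqr.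
move=> x _ /=; rewrite lee_fin !ger0_norm ?sqr_ge0//.
by apply: le_trans (fu x); exact: sqr_ge0.
Qed.

Lemma L2D l f g : L2 l f -> L2 l g -> L2 l (fun x => f x + g x).
Proof.
move=> /L2P[f1 f2 fi] /L2P[g1 g2 gi].
apply: (@L2_dom l _ (fun x => 2 * (normc (f x) ^+ 2) + 2 * (normc (g x) ^+ 2))).
- rewrite (_ : (fun x => _) = fun x => complex.Re (f x) + complex.Re (g x)).
    exact: measurable_funD.
  by apply/funext => x; rewrite ReD.
- rewrite (_ : (fun x => _) = fun x => complex.Im (f x) + complex.Im (g x)).
    exact: measurable_funD.
  by apply/funext => x; rewrite ImD.
- by apply: integrable_addr; exact: integrable_mulr.
- move=> x; rewrite !normc_sqr !ReImE.
  set a := complex.Re _; set b := complex.Re _.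
  set c := complex.Im _; set d := complex.Im _.
  have := sqr_ge0 (a - b); have := sqr_ge0 (c - d); rewrite !expr2; lra.
Qed.

Lemma L2Z l k f : L2 l f -> L2 l (fun x => k * f x).
Proof.
move=> /L2P[f1 f2 fi].
apply: (@L2_dom l _ (fun x => normc k ^+ 2 * (normc (f x) ^+ 2))).
- rewrite (_ : (fun x => _) = fun x => complex.Re k * complex.Re (f x)
    - complex.Im k * complex.Im (f x)).
    by apply: measurable_funB; apply: measurable_funM.
  by apply/funext => x; rewrite ReM.
- rewrite (_ : (fun x => _) = fun x => complex.Re k * complex.Im (f x)
    + complex.Im k * complex.Re (f x)).
    by apply: measurable_funD; apply: measurable_funM.
  by apply/funext => x; rewrite ImM.
- exact: integrable_mulr fi.
- by move=> x; rewrite normcM exprMn.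
Qed.

Lemma L2_cwithin l f : cwithin l f -> L2 l f.
Proof.
move=> [f1 f2]; apply/L2P.
have sub : `]0, l[ `<=` `[0, l] by exact: subset_itv_oo_cc.
have m (u : R -> R) : {within `[0, l], continuous u} -> measurable_fun `]0, l[ u.
  move=> uc; apply: (measurable_funS _ sub) => //.
  exact: subspace_continuous_measurable_fun.
split; [exact: m|exact: m|].
apply: integrable_cc_oo; apply: continuous_integrable.
have -> : (fun x => normc (f x) ^+ 2) =
  (fun x => complex.Re (f x) * complex.Re (f x) + complex.Im (f x) * complex.Im (f x)).
  by apply/funext => x; rewrite normc_sqr !expr2.
move=> x; exact: (continuousD (continuousM (f1 x) (f1 x)) (continuousM (f2 x) (f2 x))).
Qed.

(** On a bounded interval constants are integrable, and |f| <= 1 + |f|^2. *)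
Lemma normc_integrable l f : L2 l f -> mu.-integrable `]0, l[ (fun x => (normc (f x))%:E).
Proof.
move=> /L2P[f1 f2 fi].
have mn : measurable_fun `]0, l[ (fun x => normc (f x)).
  rewrite (_ : (fun x => _) = (fun x => Num.sqrt (normc (f x) ^+ 2))); last first.
    by apply/funext => x; rewrite sqrtr_sqr ger0_norm// normc_ge0.
  have ms : measurable_fun setT (fun x : R => Num.sqrt x).
    by apply: continuous_measurable_fun; exact: sqrt_continuous.
  have mf : measurable_fun `]0, l[ (fun x => normc (f x) ^+ 2).
    exact: measurable_normc_sqr.
  exact: (measurableT_comp ms mf).
have ui : mu.-integrable `]0, l[ (EFin \o (fun x => 1 + normc (f x) ^+ 2)).
  have ci : mu.-integrable `]0, l[ (EFin \o (fun=> 1)).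
    by apply: integrable_cc_oo; apply: continuous_integrable => x; exact: cst_continuous.
  exact: integrable_addr ci fi.
apply: le_integrable ui => //; first exact/measurable_EFinP.
move=> x _ /=; rewrite lee_fin !ger0_norm ?normc_ge0 ?addr_ge0 ?sqr_ge0//.
have := sqr_ge0 (1 - normc (f x)); rewrite !expr2; have := normc_ge0 (f x); nra.
Qed.

Lemma L2_cintegrable l f : L2 l f -> cintegrable l f.
Proof.
move=> fl; have ni := normc_integrable fl; move: fl => [f1 f2 _].
split; apply: integrable_oo_cc; apply: le_integrable ni => //.
- exact/measurable_EFinP.
- by move=> x _ /=; rewrite lee_fin (ger0_norm (normc_ge0 _)) Re_le_normc.
- exact/measurable_EFinP.
- by move=> x _ /=; rewrite lee_fin (ger0_norm (normc_ge0 _)) Im_le_normc.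
Qed.

Lemma L2norm_sqr l f :
  L2norm l f ^+ 2 = Rintegral mu `]0, l[ (fun x => normc (f x) ^+ 2).
Proof.
rewrite /L2norm sqr_sqrtr//; apply: fine_ge0.
by apply: integral_ge0 => x _; rewrite lee_fin sqr_ge0.
Qed.

Lemma L2norm_ge0 l f : 0 <= L2norm l f.
Proof. exact: sqrtr_ge0. Qed.

Lemma Rintegral_cst_oo l (c : R) : 0 <= l -> Rintegral mu `]0, l[ (fun=> c) = c * l.
Proof.
move=> l0; rewrite Rintegral_cst//; congr (c * _).
have E := @lebesgue_measure_itv R `]0, l[; apply: (etrans (congr1 fine E)) => /=.
case: ifPn => [|]; first by rewrite oppr0 adde0.
by rewrite lte_fin -leNgt => l0'; apply/eqP; rewrite eq_le l0 l0'.
Qed.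

(* AM-GM in the form [2 |f| <= a + |f|^2 / a]. *)
Lemma L1_le_L2 l f : 0 <= l -> L2 l f ->
  Rintegral mu `]0, l[ (fun x => normc (f x)) <= (l + 1) / 2 * L2norm l f.
Proof.
move=> l0 fl; set I := Rintegral _ _ _; set N := L2norm l f.
have key (a : R) : 0 < a -> I <= (a * l + a^-1 * N ^+ 2) / 2.
  move=> a0; have /L2P[_ _ fi] := fl.
  have ci : mu.-integrable `]0, l[ (EFin \o (fun=> a)).
    by apply: integrable_cc_oo; apply: continuous_integrable => x; exact: cst_continuous.
  have fi' : mu.-integrable `]0, l[ (EFin \o (fun x => a^-1 * normc (f x) ^+ 2)).
    exact: integrable_mulr fi.
  rewrite ler_pdivlMr// mulrC -RintegralZl//; last exact: normc_integrable.
  rewrite L2norm_sqr// -RintegralZl// -Rintegral_cst_oo// -RintegralD//.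
  apply: le_Rintegral => //.
  - exact: integrable_mulr (normc_integrable fl).
  - exact: integrable_addr ci fi'.
  move=> x _; set n := normc (f x).
  have a_neq0 : a != 0 by rewrite gt_eqF.
  have : 0 <= a^-1 * (n - a) ^+ 2 by rewrite mulr_ge0 ?sqr_ge0// invr_ge0 ltW.
  have -> : a^-1 * (n - a) ^+ 2 = a^-1 * n ^+ 2 - 2 * n + a by field.
  by lra.
(* For N > 0 the choice a = N gives the constant (l + 1) / 2. For N = 0 the bound is a l / 2 for
   every a > 0, and a = e / (l + 1) pushes it below any e. *)
have := L2norm_ge0 l f; rewrite -/N le_eqVlt => /predU1P[N0|N0].
  rewrite -N0 mulr0; apply/ler_addgt0Pr => e e0; rewrite add0r.
  apply: (le_trans (key (e / (l + 1)) _)); first by rewrite divr_gt0// ltr_wpDl.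
  rewrite -N0 expr2 !mulr0 addr0 ler_pdivrMr// -mulrA ler_pM2l// mulrC.
  rewrite ler_pdivrMr ?ltr_wpDl//; nra.
apply: (le_trans (key N N0)); rewrite expr2 mulKf ?gt_eqF//; lra.
Qed.

End SquareIntegrable.

(** * Vanishing almost everywhere *)

Section AlmostEverywhere.
Variable R : realType.
Local Notation mu := (@lebesgue_measure R).
Implicit Types (l x : R) (f g h y : R -> R[i]) (k z : R[i]).
Local Notation normc := Normc.normc.

Lemma cder_cst_oo (a b : R) f x d e : a < x < b ->
  (forall t, a < t < b -> f t = e) -> cder f x d -> d = 0.
Proof.
move=> xab fe fd.
suff real (u : R -> R) (c du : R) : (forall t, a < t < b -> u t = c) ->
    is_derive x 1 u du -> du = 0.
  move: fd => [f1 f2]; apply: cplxP.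
  - by apply: real f1 => t /fe ->.
  - by apply: real f2 => t /fe ->.
move=> uc ud; have : is_derive x 1 (cst c : R -> R) du.
  apply: near_eq_is_derive ud.
  have : \forall t \near x, t \in `]a, b[ by apply: near_in_itvoo; rewrite in_itv.
  by apply: filterS => t; rewrite in_itv/= => /uc.
by move=> [_ <-]; rewrite derive_cst.
Qed.

(** The sign of c makes r monotone, so equal end values make it constant; its derivative c |y|^2 is
    then 0 inside. *)
Lemma monotone_kernel (a b c : R) (r : R -> R) y : a <= b -> c != 0 ->
  (forall x, a <= x <= b -> is_derive x 1 r (c * normc (y x) ^+ 2)) ->
  r a = r b -> forall x, a < x < b -> y x = 0.
Proof.
move=> ab; wlog c0 : c r / 0 < c => [wl c0 rd rab|_ rd rab x xab].
  have [/wl|c_lt0|c_eq0] := ltgtP 0 c; first exact.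
    apply: (wl (- c) (fun x => - r x)); rewrite ?oppr_gt0 ?oppr_eq0 ?rab//.
    by move=> x /rd dr; apply: (is_derive_ext (is_deriveN dr)); rewrite // mulNr.
  by rewrite -c_eq0 eqxx in c0.
have nd s t : a <= s -> s <= t -> t <= b -> r s <= r t.
  move=> sa; rewrite le_eqVlt => /predU1P[->//|st] tb.
  have sub u : s <= u <= t -> a <= u <= b.
    by move=> /andP[su ut]; rewrite (le_trans sa) ?(le_trans ut).
  have [u /= ust||u _ E] := @MVT R r (fun x => c * normc (y x) ^+ 2) s t st.
  - by apply: rd; apply: sub; rewrite in_itv/= in ust; case/andP: ust => /ltW-> /ltW->.
  - by apply: (@is_derive_within _ _ (fun x => c * normc (y x) ^+ 2)) => u /sub /rd.
  rewrite -subr_ge0 E; apply: mulr_ge0; last by rewrite subr_ge0 ltW.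
  by apply: mulr_ge0; [exact: ltW|exact: sqr_ge0].
have rc t : a < t < b -> r t = r a.
  move=> /andP[/ltW at_ /ltW tb]; apply/eqP; rewrite eq_le; apply/andP.
  by split; [rewrite rab|]; apply: nd.
have xab' : a <= x <= b by case/andP: xab => /ltW-> /ltW->.
have cr : cder (fun t => (r t)%:C) x (c * normc (y x) ^+ 2)%:C.
  by split; [exact: rd|exact: is_derive_cst].
have rc' t : a < t < b -> (r t)%:C = (r a)%:C by move=> /rc ->.
have /(congr1 (@complex.Re R)) /= /eqP := cder_cst_oo xab rc' cr.
rewrite mulf_eq0 (gt_eqF c0) /= sqrf_eq0 => /eqP.
exact: Normc.eq0_normc.
Qed.

Lemma L2norm_ae0 l f : L2 l f -> ae_eq_on l f (fun=> 0) -> L2norm l f = 0.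
Proof.
move=> [f1 f2 _] f0; rewrite /L2norm /sq_integral.
rewrite (@ae_eq_integral _ _ _ mu _ (cst 0%E)) ?integral_cst//=.
- by rewrite mul0e /= sqrtr0.
- by apply/measurable_EFinP; exact: measurable_normc_sqr.
- have [N [mN N0 subN]] := f0; exists N; split=> // x nx; apply: subN => /= fx.
  by apply: nx => xl; rewrite /= fx// Normc.normc0 expr0n.
Qed.

Lemma L2norm_le_sup l f (B : R) : 0 <= l -> 0 <= B -> L2 l f ->
  (forall x, 0 <= x <= l -> normc (f x) <= B) -> L2norm l f <= (l + 1) * B.
Proof.
move=> l0 B0 fl fB; rewrite -(@ler_pXn2r _ 2)// ?nnegrE ?L2norm_ge0//; last first.
  by rewrite mulr_ge0// addr_ge0.
rewrite L2norm_sqr//; apply: (@le_trans _ _ (B ^+ 2 * l)).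
  rewrite -Rintegral_cst_oo//; apply: le_Rintegral => //.
  - by have /L2P[] := fl.
  - by apply: integrable_cc_oo; apply: continuous_integrable => x; exact: cst_continuous.
  - move=> x /=; rewrite in_itv/= => /andP[/ltW x0 /ltW xl].
    by rewrite ler_pXn2r// ?nnegrE ?normc_ge0// fB// x0.
by rewrite exprMn mulrC; apply: ler_wpM2r; rewrite ?sqr_ge0// expr2; nra.
Qed.

(** The passage from L^2 to the sup norm: the resolvent estimates see g only through its primitive.
    The real and the imaginary part each contribute (l + 1) / 2. *)
Lemma normc_cint_le l g x : L2 l g -> 0 <= x <= l ->
  normc (cint g x) <= (l + 1) * L2norm l g.
Proof.
move=> gl /andP[x0 xl]; have l0 := le_trans x0 xl.
have ni := normc_integrable gl.
have sub : `]0, x[ `<=` `]0, l[.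
  by move=> t /=; rewrite !in_itv/= => /andP[-> /lt_le_trans]; apply.
have nix : mu.-integrable `]0, x[ (fun x => (normc (g x))%:E) by apply: integrableS ni.
have [g1 g2] := cintegrableS (L2_cintegrable gl) xl.
have N : Rintegral mu `[0, x] (fun t => normc (g t)) <= (l + 1) / 2 * L2norm l g.
  apply: le_trans (L1_le_L2 l0 gl); rewrite /Rintegral integral_itv_bndoo; last first.
    by case/integrableP: nix.
  apply: fine_le; [exact: integrable_fin_num nix|exact: integrable_fin_num ni|].
  apply: ge0_subset_integral => //; first by case/integrableP: ni.
  by move=> t _; rewrite lee_fin normc_ge0.
have nic : mu.-integrable `[0, x] (EFin \o (fun t => normc (g t))).
  exact: integrable_oo_cc.
have half (u : R -> R) : mu.-integrable `[0, x] (EFin \o u) ->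
    (forall t, `|u t| <= normc (g t)) ->
    `|Rintegral mu `[0, x] u| <= (l + 1) / 2 * L2norm l g.
  move=> ui un; apply: le_trans N; apply: le_trans (le_normr_Rintegral _ ui) _ => //.
  by apply: le_Rintegral => //; exact: integrable_norm ui.
apply: le_trans (normc_le_ReIm _) _ => /=.
have h1 := half _ g1 (fun t => Re_le_normc (g t)).
have h2 := half _ g2 (fun t => Im_le_normc (g t)).
apply: le_trans (lerD h1 h2) _; rewrite -mulrDl.
by apply: ler_wpM2r; rewrite ?L2norm_ge0//; lra.
Qed.

Lemma L2norm_eq l f g : (forall x, normc (f x) = normc (g x)) -> L2norm l f = L2norm l g.
Proof.
move=> fg; rewrite /L2norm /sq_integral; congr (Num.sqrt (fine _)).
by apply: eq_integral => x _; rewrite fg.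
Qed.

(** By [normc_cint_le] the integral of f over every [0, t] vanishes. A primitive of f is therefore
    constant, and its derivative f is 0 at every interior point. *)
Lemma L2norm0_continuous l f : ccont f -> L2norm l f = 0 ->
  forall x, 0 < x < l -> f x = 0.
Proof.
move=> fc f0 x xl; have fw := ccont_within l fc.
have [H _ dH] := @ex_cprimitive R (-2) (-1) 0 f ltac:(lra)
  (fun x _ => fc.1 x) (fun x _ => fc.2 x).
have dH' t : 0 <= t <= l -> cder H t (f t).
  by move=> /andP[t0 _]; apply: dH; apply: lt_le_trans t0; rewrite oppr_lt0.
have xl' : 0 <= x <= l by case/andP: xl => /ltW-> /ltW->.
apply: (cder_cst_oo (e := H 0) xl _ (dH' x xl')) => t /andP[/ltW t0 /ltW tl].
have tl' : 0 <= t <= l by rewrite t0.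
have := normc_cint_le (L2_cwithin fw) tl'; rewrite f0 mulr0 => c0.
have /Normc.eq0_normc : normc (cint f t) = 0 by apply/eqP; rewrite eq_le c0 normc_ge0.
by rewrite (cFTC2 dH' fw tl') => /eqP; rewrite subr_eq0 => /eqP.
Qed.

Lemma L2normZ l k f : L2 l f -> L2norm l (fun x => k * f x) = normc k * L2norm l f.
Proof.
move=> fl; apply/eqP.
rewrite -(@eqrXn2 _ 2) ?L2norm_ge0 ?mulr_ge0 ?normc_ge0 ?L2norm_ge0//.
rewrite exprMn !L2norm_sqr.
have /L2P[_ _ fi] := fl.
by rewrite -RintegralZl//; apply/eqP/eq_Rintegral => x _; rewrite normcM exprMn.
Qed.

End AlmostEverywhere.

(** * The boundary value problem *)

Section BoundaryValueProblem.
Variable R : realType.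
Local Notation mu := (@lebesgue_measure R).
Implicit Types (l x : R) (f g h y : R -> R[i]) (k z theta lambda : R[i]).
Local Notation normc := Normc.normc.
Local Notation S0 := s0_quot.
Local Notation S1 := s1_quot.
Local Notation S2 := s2_quot.

Lemma ae_eq_onW l f g : (forall x, 0 < x < l -> f x = g x) -> ae_eq_on l f g.
Proof. by move=> fg; apply: aeW => x /=; rewrite in_itv; exact: fg. Qed.

Lemma L2_eq l f g : (forall x, 0 < x < l -> f x = g x) -> L2 l f -> L2 l g.
Proof.
move=> fg /L2P[f1 f2 fi]; apply/L2P; split.
- by apply: eq_measurable_fun f1 => x; rewrite inE/= in_itv/= => /fg ->.
- by apply: eq_measurable_fun f2 => x; rewrite inE/= in_itv/= => /fg ->.
- by apply: eq_integrable fi => // x; rewrite inE/= in_itv/= => /fg ->.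
Qed.

Lemma W23_L2 l y y1 y2 y3 : 0 <= l -> W23 l y y1 y2 y3 -> L2 l y.
Proof.
move=> l0 /(W23_analysis 0 l0)[_ [Y [Y1 [W [G [_ dY _ _ E]]]]]].
apply: L2_eq (L2_cwithin (cder_within dY)) => x /andP[/ltW x0 /ltW xl].
by have [|-> _ _] := E x; rewrite ?x0.
Qed.

Lemma W23_rhs_L2 l k y y1 y2 y3 : 0 <= l -> W23 l y y1 y2 y3 ->
  L2 l (fun t => y3 t - k * y t).
Proof.
move=> l0 yW; have yL := W23_L2 l0 yW; case: yW => _ _ _ y3L.
by apply: L2_eq (L2D y3L (L2Z (- k) yL)) => x _; rewrite mulNr.
Qed.

(** Subtracting the particular solution from (Y, Y1, W) cancels G and leaves a solution of the
    homogeneous system, to which [fund_unique] applies. The constant c is W(0), that is y''(0),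
    because G(0) = 0. *)
Lemma solution_form l z : 0 <= l -> exists C : R, 0 <= C /\
  forall y y1 y2 y3, W23 l y y1 y2 y3 -> y 0 = 0 ->
  exists (P Q : R -> R[i]) (c : R[i]),
  (forall x, 0 <= x <= l ->
    y x = P x + S1 z x * y1 0 + S2 z x * c /\
    y1 x = Q x + S0 z x * y1 0 + S1 z x * c) /\
  forall B, (forall x, 0 <= x <= l ->
      normc (cint (fun t => y3 t - z ^+ 3 * y t) x) <= B) ->
    forall x, 0 <= x <= l -> normc (P x) <= C * B /\ normc (Q x) <= C * B.
Proof.
move=> l0; have [C [C0 CP]] := particular_solution z l0; exists C; split=> //.
move=> y y1 y2 y3 yW y0.
have [_ [Y [Y1 [W [G [Gc dY dY1 dW E]]]]]] := W23_analysis (z ^+ 3) l0 yW.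
have [P [Q [V [[P0 Q0 V0] dP dQ dV PQB]]]] := CP G Gc.
have l00 : (0 : R) <= 0 <= l by apply/andP; split.
have [y0E y10E _] := E 0 l00.
exists P, Q, (W 0); split; last first.
  by move=> B gB; apply: PQB => x xl; have [_ _ ->] := E x xl; exact: gB.
have dw x : 0 <= x <= l -> cder (fun t => Y t - P t) x (Y1 x - Q x).
  by move=> xl; exact: cderB (dY x xl) (dP x xl).
have dw1 x : 0 <= x <= l -> cder (fun t => Y1 t - Q t) x (W x - V x).
  move=> xl; apply: (cder_ext (cderB (dY1 x xl) (dQ x xl))) => //.
  by rewrite opprD addrACA subrr addr0.
have dw2 x : 0 <= x <= l -> cder (fun t => W t - V t) x (z ^+ 3 * (Y x - P x)).
  by move=> xl; apply: (cder_ext (cderB (dW x xl) (dV x xl))); rewrite // mulrBr.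
(* The derivative of a solution solves the same equation; [fund_unique] on this shifted triple
   yields the formula for y'. *)
have dw3 x : 0 <= x <= l ->
    cder (fun t => z ^+ 3 * (Y t - P t)) x (z ^+ 3 * (Y1 x - Q x)).
  by move=> xl; apply: cderZ; exact: dw.
move=> x xl; have [yx y1x _] := E x xl.
have Y00 : Y 0 = 0 by rewrite -y0E.
split.
- have /eqP := fund_unique dw dw1 dw2 xl.
  rewrite Y00 P0 Q0 V0 !subr0 mulr0 add0r subr_eq -yx -y10E => /eqP ->.
  by rewrite addrC addrA.
- have /eqP := fund_unique dw1 dw2 dw3 xl.
  rewrite Y00 P0 Q0 V0 !subr0 !mulr0 addr0 subr_eq -y1x -y10E => /eqP ->.
  by rewrite addrC addrA.
Qed.

(* The determinant of the system for (y'(0), c) in [solution_form]. *)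
Definition bvp_det l theta z : R[i] := S1 z l ^+ 2 - S0 z l * S2 z l + theta * S2 z l.

Lemma Delta_det l theta lambda :
  Delta l theta lambda = - bvp_det l theta ('i%C * lambda).
Proof. exact: Delta_fund. Qed.

(** The conditions at l read S1 a + S2 c = - P(l) and (S0 - theta) a + S1 c = - Q(l), with a =
    y'(0). Cramer's rule bounds a and c by P(l) and Q(l), and the constant adds up the three terms
    of [solution_form]. *)
Lemma boundary_bound l theta z : 0 <= l -> bvp_det l theta z != 0 ->
  exists C : R, 0 <= C /\ forall y y1 y2 y3, W23 l y y1 y2 y3 ->
    y 0 = 0 -> y1 l = theta * y1 0 -> y l = 0 -> forall B,
    (forall x, 0 <= x <= l ->
      normc (cint (fun t => y3 t - z ^+ 3 * y t) x) <= B) ->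
    forall x, 0 <= x <= l -> normc (y x) <= C * B.
Proof.
move=> l0 D0; have [C [C0 CP]] := solution_form z l0.
pose d := normc (bvp_det l theta z)^-1.
pose e0 := normc (S1 z l); pose e2 := normc (S2 z l).
pose e1 := normc (S0 z l - theta).
have [M1 M10 M1P] := ccont_bounded l0 (ccont_s1_quot z).
have [M2 M20 M2P] := ccont_bounded l0 (ccont_s2_quot z).
have d0 : 0 <= d by exact: normc_ge0.
have [e00 e10 e20] : [/\ 0 <= e0, 0 <= e1 & 0 <= e2] by split; exact: normc_ge0.
exists (C + M1 * (d * (e2 * C + e0 * C)) + M2 * (d * (e1 * C + e0 * C))); split.
  by rewrite !(addr_ge0, mulr_ge0).
move=> y y1 y2 y3 yW y0 y1l yl B gB x xl.
have [P [Q [c [E /(_ B gB) PQ]]]] := CP _ _ _ _ yW y0.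
have ll : 0 <= l <= l by apply/andP; split.
have [El E1l] := E l ll; have [Pl Ql] := PQ l ll.
have Pl' : normc (P l) <= C * B by [].
pose a := y1 0.
have Ea : a = (bvp_det l theta z)^-1 * (S2 z l * Q l + (- S1 z l) * P l).
  apply: (mulfI D0); rewrite mulVKf// /bvp_det.
  have h1 : P l = - (S1 z l * a + S2 z l * c).
    by apply/eqP; rewrite -subr_eq0 opprK addrA -El yl.
  have h2 : Q l = theta * a - S0 z l * a - S1 z l * c.
    by rewrite /a -y1l E1l; ring.
  by rewrite h1 h2; ring.
have Ec : c = (bvp_det l theta z)^-1 * ((S0 z l - theta) * P l + (- S1 z l) * Q l).
  apply: (mulfI D0); rewrite mulVKf// /bvp_det.
  have h1 : P l = - (S1 z l * a + S2 z l * c).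
    by apply/eqP; rewrite -subr_eq0 opprK addrA -El yl.
  have h2 : Q l = theta * a - S0 z l * a - S1 z l * c.
    by rewrite /a -y1l E1l; ring.
  by rewrite h1 h2; ring.
have Na : normc a <= d * (e2 * (C * B) + e0 * (C * B)).
  rewrite Ea; apply: normcM_le => //; apply: normcD_le; apply: normcM_le => //.
  by rewrite normcN.
have Nc : normc c <= d * (e1 * (C * B) + e0 * (C * B)).
  rewrite Ec; apply: normcM_le => //; apply: normcD_le; apply: normcM_le => //.
  by rewrite normcN.
have -> : (C + M1 * (d * (e2 * C + e0 * C)) + M2 * (d * (e1 * C + e0 * C))) * B =
  C * B + M1 * (d * (e2 * (C * B) + e0 * (C * B)))
  + M2 * (d * (e1 * (C * B) + e0 * (C * B))) by ring.
have [-> _] := E x xl; have [Px _] := PQ x xl.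
apply: normcD_le; first apply: normcD_le => //; apply: normcM_le => //.
  exact: M1P.
exact: M2P.
Qed.

Lemma iX3 lambda : ('i%C * lambda) ^+ 3 = - ('i%C * lambda ^+ 3).
Proof. by rewrite exprMn exprS sqr_i mulrN1 mulNr. Qed.

Lemma normc_i : normc ('i%C : R[i]) = 1.
Proof. by rewrite /= expr0n /= expr1n add0r sqrtr1. Qed.

(** Since i z^3 = lambda^3 for z = i lambda, the left argument is i times the right one. *)
Lemma normc_rhs lambda (y3 y : R[i]) :
  normc ('i%C * y3 - lambda ^+ 3 * y) = normc (y3 - ('i%C * lambda) ^+ 3 * y).
Proof.
have := normcM 'i%C (y3 - ('i%C * lambda) ^+ 3 * y); rewrite normc_i mul1r => <-.
have ii : ('i%C : R[i]) * 'i%C = -1 by rewrite -expr2 sqr_i.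
rewrite iX3; congr normc.
transitivity ('i%C * y3 + ('i%C * 'i%C) * (lambda ^+ 3 * y)); last by ring.
by rewrite ii mulN1r.
Qed.

Lemma resolvent_bound l theta lambda : 0 <= l -> Delta l theta lambda != 0 ->
  exists C : R, 0 <= C /\ forall y h, L0 l theta y h ->
    [/\ L2 l y, L2 l (fun x => h x - lambda ^+ 3 * y x) &
    forall x, 0 <= x <= l ->
      normc (y x) <= C * L2norm l (fun x => h x - lambda ^+ 3 * y x)].
Proof.
move=> l0; rewrite Delta_det oppr_eq0 => /(boundary_bound l0)[C [C0 CP]].
exists (C * (l + 1)); split; first by rewrite mulr_ge0 ?addr_ge0.
move=> y h [y1 [y2 [y3 [yW y0 y1l yl hE]]]].
have gL := W23_rhs_L2 (('i%C * lambda) ^+ 3) l0 yW.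
have yL := W23_L2 l0 yW.
have -> : L2norm l (fun x => h x - lambda ^+ 3 * y x) =
    L2norm l (fun x => y3 x - ('i%C * lambda) ^+ 3 * y x).
  by apply: L2norm_eq => x; rewrite hE normc_rhs.
split=> //.
  case: yW => _ _ _ y3L.
  by apply: L2_eq (L2D (L2Z 'i%C y3L) (L2Z (- lambda ^+ 3) yL)) => x _; rewrite hE mulNr.
move=> x xl; rewrite -mulrA; apply: (CP y y1 y2 y3) => // t tl.
exact: normc_cint_le.
Qed.

(** Converse of [W23_analysis]: y'' is a differentiable function with derivative z^3 y plus the
    primitive G of g, hence an indefinite integral of z^3 y + g. *)
Lemma W23_synthesis l z (a c : R[i]) g G P Q V :
  L2 l g -> ccont G -> (forall x, 0 <= x <= l -> G x = cint g x) -> 0 <= l ->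
  (forall x, 0 <= x <= l -> cder P x (Q x)) ->
  (forall x, 0 <= x <= l -> cder Q x (V x + G x)) ->
  (forall x, 0 <= x <= l -> cder V x (z ^+ 3 * P x)) ->
  let y x := a * S1 z x + c * S2 z x + P x in
  let y1 x := a * S0 z x + c * S1 z x + Q x in
  let y2 x := a * (z ^+ 3 * S2 z x) + c * S0 z x + V x + G x in
  W23 l y y1 y2 (fun x => z ^+ 3 * y x + g x).
Proof.
move=> gL Gc GE l0 dP dQ dV y y1 y2.
have dy x : 0 <= x <= l -> cder y x (y1 x).
  move=> xl; exact: (cderD (cderD (cderZ a (cder_s1_quot z x))
    (cderZ c (cder_s2_quot z x))) (dP x xl)).
have dy1 x : 0 <= x <= l -> cder y1 x (y2 x).
  move=> xl; apply: (cder_ext (cderD (cderD (cderZ a (cder_s0_quot z x))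
    (cderZ c (cder_s1_quot z x))) (dQ x xl))) => //.
  by rewrite /y2 addrA.
pose v x := a * (z ^+ 3 * S2 z x) + c * S0 z x + V x.
have dv x : 0 <= x <= l -> cder v x (z ^+ 3 * y x).
  move=> xl; apply: (cder_ext (cderD (cderD (cderZ a (cderZ (z ^+ 3) (cder_s2_quot z x)))
    (cderZ c (cder_s0_quot z x))) (dV x xl))) => //.
  by rewrite /y; ring.
have yw := cder_within dy.
have y1w := cder_within dy1.
have kyw : cwithin l (fun x => z ^+ 3 * y x).
  by apply: (@cder_within _ _ _ (fun x => z ^+ 3 * y1 x)) => x xl; exact/cderZ/dy.
have kyi := cwithin_integrable kyw.
have gi := L2_cintegrable gL.
have y2w : cwithin l y2.
  have [v1 v2] := cder_within dv; have [G1 G2] := ccont_within l Gc; split.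
    rewrite (_ : (fun t => _) = fun t => complex.Re (v t) + complex.Re (G t)).
      by move=> x; exact: (continuousD (v1 x) (G1 x)).
    by apply/funext => t; rewrite -ReD.
  rewrite (_ : (fun t => _) = fun t => complex.Im (v t) + complex.Im (G t)).
    by move=> x; exact: (continuousD (v2 x) (G2 x)).
  by apply/funext => t; rewrite -ImD.
split.
- exact: cder_abs_cont.
- exact: cder_abs_cont.
- apply/abs_cont_derivP; split; first exact: cintegrableD.
  move=> x xl; have xl' := (andP xl).2.
  have G0 : G 0 = 0.
    rewrite GE ?lexx//; apply: cplxP => /=; by rewrite set_itv1 Rintegral_set1.
  rewrite cintD; [|exact: cintegrableS kyi xl'|exact: cintegrableS gi xl'].
  rewrite (cFTC2 dv kyw xl) -GE// /y2 -/(v x) -/(v 0) G0; ring.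
- exact: L2D (L2_cwithin kyw) gL.
Qed.

Lemma resolvent_surjective l theta lambda f : 0 <= l -> Delta l theta lambda != 0 ->
  L2 l f -> exists y h, L0 l theta y h /\
    ae_eq_on l (fun x => h x - lambda ^+ 3 * y x) f.
Proof.
move=> l0; rewrite Delta_det oppr_eq0; set z := 'i%C * lambda => D0 fL.
have [C [_ CP]] := particular_solution z l0.
(* The factor - i inverts the factor i of the operator: i (z^3 y + g) - lambda^3 y = f. *)
pose g x := - 'i%C * f x.
have gL : L2 l g by exact: L2Z.
have [G Gc GE] := cint_extension (L2_cintegrable gL).
have [P [Q [V [[P0 Q0 V0] dP dQ dV _]]]] := CP G Gc.
(* Cramer's rule for the system of [boundary_bound]. *)
pose a := (bvp_det l theta z)^-1 * (S2 z l * Q l - S1 z l * P l).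
pose c := (bvp_det l theta z)^-1 * ((S0 z l - theta) * P l - S1 z l * Q l).
have yW := W23_synthesis a c gL Gc GE l0 dP dQ dV.
set y := (fun x : R => a * S1 z x + _ + P x) in yW.
exists y, (fun x => 'i%C * (z ^+ 3 * y x + g x)); split.
  exists (fun x => a * S0 z x + c * S1 z x + Q x),
    (fun x => a * (z ^+ 3 * S2 z x) + c * S0 z x + V x + G x),
    (fun x => z ^+ 3 * y x + g x); split=> //.
  - by rewrite /y s1_quot_at0 s2_quot_at0 P0 !mulr0 !addr0.
  - rewrite s0_quot_at0 s1_quot_at0 Q0 mulr0 mulr1 !addr0.
    rewrite /a /c; move: D0; rewrite /bvp_det => D0; field.
    by rewrite D0.
  - by rewrite /y /a /c; move: D0; rewrite /bvp_det => D0; field; rewrite D0.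
apply: ae_eq_onW => x _; rewrite /g /z iX3.
have ii : ('i%C : R[i]) * 'i%C = -1 by rewrite -expr2 sqr_i.
transitivity (- ('i%C * 'i%C) * (lambda ^+ 3 * y x) - ('i%C * 'i%C) * f x
  - lambda ^+ 3 * y x); first by ring.
by rewrite ii; ring.
Qed.

Lemma homogeneous_L0 l theta lambda (a c : R[i]) : 0 <= l ->
  let z := 'i%C * lambda in
  a * S1 z l + c * S2 z l = 0 ->
  a * S0 z l + c * S1 z l = theta * a ->
  L0 l theta (fun x => a * S1 z x + c * S2 z x)
    (fun x => lambda ^+ 3 * (a * S1 z x + c * S2 z x)).
Proof.
move=> l0 z e1 e2.
have zl : L2 l (fun=> 0) by apply: L2_cwithin; split=> x; exact: cst_continuous.
have zc : ccont (fun=> 0 : R[i]) by split=> x; exact: cst_continuous.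
have zE x : 0 <= x <= l -> (0 : R[i]) = cint (fun=> 0) x.
  by move=> _; rewrite /cint /=; apply: cplxP => /=; rewrite /Rintegral integral0.
have d0 (b : R[i]) x : b = 0 -> 0 <= x <= l -> cder (fun=> 0 : R[i]) x b.
  by move=> -> _; exact: cder_cst.
(* The zero summands are the vanishing P, Q, V and G of [W23_synthesis]. *)
pose y x := a * S1 z x + c * S2 z x + 0.
pose y1 x := a * S0 z x + c * S1 z x + 0.
pose y2 x := a * (z ^+ 3 * S2 z x) + c * S0 z x + 0 + 0.
pose y3 x := z ^+ 3 * y x + 0.
have yW : W23 l y y1 y2 y3 := @W23_synthesis l z a c
  (fun=> 0) (fun=> 0) (fun=> 0) (fun=> 0) (fun=> 0)
  zl zc zE l0 (fun x => d0 _ x erefl) (fun x => d0 _ x (addr0 0))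
  (fun x => d0 _ x (mulr0 _)).
have yE x : a * S1 z x + c * S2 z x = y x by rewrite /y addr0.
rewrite (_ : (fun x => a * S1 z x + c * S2 z x) = y); last by apply/funext.
exists y1, y2, y3; split=> //.
- by rewrite /y s1_quot_at0 s2_quot_at0 !mulr0 !addr0.
- by rewrite /y1 !addr0 e2 s0_quot_at0 s1_quot_at0 mulr0 mulr1 addr0.
- by rewrite /y e1 addr0.
- move=> x; rewrite /y3 /z iX3 addr0 yE.
  have ii : ('i%C : R[i]) * 'i%C = -1 by rewrite -expr2 sqr_i.
  transitivity (- ('i%C * 'i%C) * (lambda ^+ 3 * y x)); last by ring.
  by rewrite ii opprK mul1r.
Qed.

End BoundaryValueProblem.

(** * Reality of the spectrum *)

Section RealSpectrum.
Variable R : realType.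
Implicit Types (l x : R) (f g h y : R -> R[i]) (k z theta lambda : R[i]).
Local Notation normc := Normc.normc.
Local Notation S0 := s0_quot.
Local Notation S1 := s1_quot.
Local Notation S2 := s2_quot.

Lemma cder_fund z (a c : R[i]) x :
  [/\ cder (fun t => a * S1 z t + c * S2 z t) x (a * S0 z x + c * S1 z x),
    cder (fun t => a * S0 z t + c * S1 z t) x (a * (z ^+ 3 * S2 z x) + c * S0 z x) &
    cder (fun t => a * (z ^+ 3 * S2 z t) + c * S0 z t) x
      (z ^+ 3 * (a * S1 z x + c * S2 z x)) ].
Proof.
split.
- exact: (cderD (cderZ a (cder_s1_quot z x)) (cderZ c (cder_s2_quot z x))).
- exact: (cderD (cderZ a (cder_s0_quot z x)) (cderZ c (cder_s1_quot z x))).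
- apply: (cder_ext (cderD (cderZ a (cderZ (z ^+ 3) (cder_s2_quot z x)))
    (cderZ c (cder_s0_quot z x)))) => //; ring.
Qed.

(** All of y, y', y'' vanish at the midpoint. The second and third rows of M(-x), applied to this
    zero state, return y'(0) = a and y''(0) = c. *)
Lemma fund_free z (a c : R[i]) (u v : R) : u < v ->
  (forall x, u < x < v -> a * S1 z x + c * S2 z x = 0) -> a = 0 /\ c = 0.
Proof.
move=> uv y0.
have y10 x : u < x < v -> a * S0 z x + c * S1 z x = 0.
  by move=> xuv; have [/(cder_cst_oo xuv y0)] := cder_fund z a c x.
have y20 x : u < x < v -> a * (z ^+ 3 * S2 z x) + c * S0 z x = 0.
  by move=> xuv; have [_ /(cder_cst_oo xuv y10)] := cder_fund z a c x.
pose x := (u + v) / 2.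
have xuv : u < x < v by apply/andP; rewrite /x; split; lra.
have e0 := y0 x xuv; have e1 := y10 x xuv; have e2 := y20 x xuv.
have i0 := fund_inv0 z x; have i1 := fund_inv1 z x; have i2 := fund_inv2 z x.
split.
- have : a * 1 + c * 0 = S0 z (- x) * (a * S0 z x + c * S1 z x)
    + S1 z (- x) * (a * (z ^+ 3 * S2 z x) + c * S0 z x)
    + z ^+ 3 * S2 z (- x) * (a * S1 z x + c * S2 z x).
    by rewrite -i0 -i1; ring.
  by rewrite e0 e1 e2 !mulr0 !addr0 mulr1.
- have : c * 1 + a * z ^+ 3 * 0 = S0 z (- x) * (a * (z ^+ 3 * S2 z x) + c * S0 z x)
    + z ^+ 3 * S1 z (- x) * (a * S1 z x + c * S2 z x)
    + z ^+ 3 * S2 z (- x) * (a * S0 z x + c * S1 z x).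
    by rewrite -i0 -i2; ring.
  by rewrite e0 e1 e2 !mulr0 !addr0 mulr1.
Qed.

Lemma ReMJ (w : R[i]) : complex.Re (w * conjc w) = normc w ^+ 2.
Proof. by rewrite normc_sqr !ReImE; ring. Qed.

Lemma ImMJ (w : R[i]) : complex.Im (w * conjc w) = 0.
Proof. by rewrite !ReImE; ring. Qed.

(* Lagrange's identity for i y''', on the diagonal. *)
Lemma lagrange_derive y y1 y2 k x :
  cder y x (y1 x) -> cder y1 x (y2 x) -> cder y2 x (k * y x) ->
  is_derive x 1 (fun t => 2 * complex.Re (y2 t * conjc (y t)) - normc (y1 t) ^+ 2)
    (2 * complex.Re k * normc (y x) ^+ 2).
Proof.
move=> d0 d1 d2.
have [D _] := cderB (cderD (cderM d2 (cderJ d0)) (cderM d0 (cderJ d2)))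
  (cderM d1 (cderJ d1)).
apply: (is_derive_ext D) => [t|].
  by rewrite normc_sqr !ReImE; ring.
by rewrite normc_sqr !ReImE; ring.
Qed.

(** The kernel vector is (- S2(l), S1(l)), the coefficients of [psi_num]. It degenerates only if
    S2(l) = 0; then the determinant is S1(l)^2, so S1(l) = 0 as well and (0, 1) works. *)
Lemma boundary_kernel l theta z : bvp_det l theta z = 0 ->
  exists a c : R[i], [/\ ~ (a = 0 /\ c = 0), a * S1 z l + c * S2 z l = 0 &
    a * S0 z l + c * S1 z l = theta * a].
Proof.
rewrite /bvp_det => D0; have [s20|s20] := eqVneq (S2 z l) 0.
  move: D0; rewrite s20 !mulr0 subr0 addr0 => /eqP; rewrite sqrf_eq0 => /eqP s10.
  exists 0, 1; rewrite s10 !mulr0 !mul0r !addr0; split=> // -[_ /eqP].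
  by rewrite oner_eq0.
exists (- S2 z l), (S1 z l); split.
- by move=> [/eqP]; rewrite oppr_eq0 (negPf s20).
- by ring.
- apply/eqP; rewrite -subr_eq0 -D0; apply/eqP; ring.
Qed.

Lemma theta_normc theta : `|theta| = 1 -> normc theta = 1.
Proof. by move=> /(congr1 (@complex.Re R)). Qed.

(** Lagrange's form 2 Re(y'' conj(y)) - |y'|^2 agrees at 0 and l, because y vanishes at both ends
    and |y'(l)| = |theta| |y'(0)|. Its derivative is 2 Re(z^3) |y|^2 with Re(z^3) = Im(lambda^3), so
    a nonreal lambda^3 would force y = 0. *)
Lemma zero_real l theta lambda : 0 < l -> `|theta| = 1 ->
  Delta l theta lambda = 0 -> complex.Im (lambda ^+ 3) = 0.
Proof.
move=> l0 /theta_normc th1; rewrite Delta_det => /eqP; rewrite oppr_eq0 => /eqP.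
set z := 'i%C * lambda => /boundary_kernel[a [c [ac0 e1 e2]]].
have Rek : complex.Re (z ^+ 3) = complex.Im (lambda ^+ 3).
  by rewrite /z iX3 !ReImE /= !(mul0r, mul1r, sub0r, opprK).
apply/eqP; apply: contra_notT ac0 => Im0.
apply: (fund_free l0); apply: (@monotone_kernel R 0 l (2 * complex.Re (z ^+ 3))
  (fun t => 2 * complex.Re ((a * (z ^+ 3 * S2 z t) + c * S0 z t)
    * conjc (a * S1 z t + c * S2 z t)) - normc (a * S0 z t + c * S1 z t) ^+ 2)).
- exact: ltW.
- by rewrite mulf_neq0// Rek.
- by move=> x _; have [d0 d1 d2] := cder_fund z a c x; exact: lagrange_derive d0 d1 d2.
- rewrite s0_quot_at0 s1_quot_at0 s2_quot_at0 e1 e2 !mulr0 !addr0 conjc0 !mulr0 mulr1.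
  by rewrite normcM th1 mul1r.
Qed.

Lemma i_real_exp3 (t : R) : complex.Re (('i%C * t%:C) ^+ 3) = 0.
Proof. by rewrite iX3 -rmorphXn /=; ring. Qed.

(* The derivative of r = Re (S1 conj(S2)) is 3/2 |S1|^2, because b, the boundary
   form of S2, is constant and vanishes at 0. *)
Lemma s2_quot_neq0 l (t : R) : 0 < l -> S2 ('i%C * t%:C) l != 0.
Proof.
move=> l0; apply/eqP => s20; set z := 'i%C * t%:C in s20.
have l00 := ltW l0.
pose r x := complex.Re (S1 z x * conjc (S2 z x)).
pose b x := 2 * complex.Re (S0 z x * conjc (S2 z x)) - normc (S1 z x) ^+ 2.
have b0 x : 0 <= x -> b x = 0.
  move=> x0; transitivity (b 0); last first.
    by rewrite /b s1_quot_at0 s2_quot_at0 conjc0 mulr0 Normc.normc0 expr0n /= mulr0 subr0.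
  apply/esym; apply: is_derive_0_cst_on => // u _.
  apply: (is_derive_ext (lagrange_derive (cder_s2_quot z u) (cder_s1_quot z u)
    (cder_s0_quot z u))) => //.
  by rewrite /z i_real_exp3 mulr0 mul0r.
have dr x : 0 <= x <= l -> is_derive x 1 r (3 / 2 * normc (S1 z x) ^+ 2).
  move=> /andP[x0 _]; have [d _] := cderM (cder_s1_quot z x) (cderJ (cder_s2_quot z x)).
  apply: (is_derive_ext d) => //; rewrite ReD ReMJ; have := b0 x x0; rewrite /b; lra.
have S10 : forall x, 0 < x < l -> S1 z x = 0.
  apply: (@monotone_kernel R 0 l (3 / 2) r (S1 z) l00 _ dr).
    by rewrite gt_eqF//; lra.
  by rewrite /r s20 s2_quot_at0 conjc0 !mulr0.
have [|/eqP] := @fund_free z 1 0 0 l l0; last by rewrite oner_eq0.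
by move=> x /S10 ->; rewrite mulr0 mul0r addr0.
Qed.

(* At lambda = 1 the phase of S2 has derivative Im (S1 conj(S2)) / |S2|^2. *)
Lemma phase_derivative_neq0 (x : R) : x != 0 ->
  complex.Im (S1 'i%C x * conjc (S2 'i%C x)) != 0.
Proof.
move=> x0; pose z : R[i] := 'i%C; rewrite -/z.
have k0 : complex.Re (z ^+ 3) = 0.
  by have := i_real_exp3 1; rewrite rmorph1 mulr1.
have k1 : complex.Im (z ^+ 3) = - 1.
  by rewrite /z exprS sqr_i mulrN1.
pose m x := complex.Im (S1 z x * conjc (S2 z x)).
pose p x := complex.Im (S0 z x * conjc (S2 z x)).
(* A first integral with value 0. It replaces Im(S0 conj(S1)) by - |S2|^2 / 2, so that m'' = p'
   becomes - (3/2) |S2|^2. *)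
pose n x := complex.Im (S0 z x * conjc (S1 z x)) + 2^-1 * normc (S2 z x) ^+ 2.
have n0 u : n u = 0.
  transitivity (n 0); last first.
    by rewrite /n s1_quot_at0 s2_quot_at0 conjc0 mulr0 Normc.normc0 expr0n /= mulr0 addr0.
  apply: is_derive_0_is_cst => v.
  have [_ d1] := cderM (cder_s0_quot z v) (cderJ (cder_s1_quot z v)).
  have [d2 _] := cderM (cder_s2_quot z v) (cderJ (cder_s2_quot z v)).
  apply: (is_derive_ext (is_deriveD d1 (is_deriveZ 2^-1 d2))) => [w|].
    by rewrite /n -ReMJ.
  rewrite /GRing.scale /= ImD ImMJ addr0 -mulrA ImM k0 k1 !ReImE.
  set a := complex.Re _; set b := complex.Im _.
  set c := complex.Re _; set d := complex.Im _.
  by field.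
have dm (u : R) : is_derive u 1 m (p u).
  have [_ d] := cderM (cder_s1_quot z u) (cderJ (cder_s2_quot z u)).
  by apply: (is_derive_ext d) => //; rewrite ImD ImMJ addr0.
have dp (u : R) : is_derive u 1 p (- (3 / 2) * normc (S2 z u) ^+ 2).
  have [_ d] := cderM (cder_s0_quot z u) (cderJ (cder_s2_quot z u)).
  apply: (is_derive_ext d) => //; rewrite ImD -mulrA ImM ImMJ mulr0 add0r k1 ReMJ.
  by have := n0 u; rewrite /n; lra.
have no_const (u v : R) : u < v -> p u = p v -> False.
  move=> uv puv; have S20 : forall t, u < t < v -> S2 z t = 0.
    apply: (@monotone_kernel R u v (- (3 / 2)) p (S2 z) (ltW uv) _ (fun t _ => dp t) puv).
    by rewrite oppr_eq0 gt_eqF//; lra.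
  have [|_ /eqP] := @fund_free z 0 1 u v uv; last by rewrite oner_eq0.
  by move=> t /S20 ->; rewrite mulr0 mul0r addr0.
have m0 : m 0 = 0 by rewrite /m s2_quot_at0 conjc0 mulr0.
have p0 : p 0 = 0 by rewrite /p s2_quot_at0 conjc0 mulr0.
(* A zero of m at x, besides the one at 0, gives a zero of p strictly between them. As p(0) = 0 too,
   p would take equal values at two points, against [no_const]. *)
have rolle (u v : R) : u < v -> m u = m v -> exists2 w, u < w < v & p w = 0.
  move=> uv muv; have [t _||w] := @Rolle R m u v uv _ _ muv.
  - by have [] := dm t.
  - by apply: (@is_derive_within _ m p) => t _; exact: dm.
  rewrite in_itv/= => uwv dw; exists w => //.
  by rewrite -(@derive_val _ _ _ _ _ _ _ (dm w)) derive_val.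
apply/eqP => mx; have [xneg|xpos|xeq] := ltgtP x 0.
- have [|w /andP[xw w0] pw] := rolle x 0 xneg; first by rewrite m0.
  by apply: (no_const w 0) => //; rewrite pw p0.
- have [|w /andP[w0 wx] pw] := rolle 0 x xpos; first by rewrite m0.
  by apply: (no_const 0 w) => //; rewrite pw p0.
- by rewrite xeq eqxx in x0.
Qed.

End RealSpectrum.

(** * The real zeros of the characteristic function *)

Section RealZeros.
Variable R : realType.
Implicit Types (l x : R) (theta : R[i]).
Local Notation normc := Normc.normc.
Local Notation S0 := s0_quot.
Local Notation S1 := s1_quot.
Local Notation S2 := s2_quot.

(** * Countability of the real zeros *)

Lemma isolated_zero (F : R -> R) (x d : R) : F x = 0 -> d != 0 ->
  is_derive x 1 F d ->
  exists2 e : R, 0 < e & forall y, y != x -> `|y - x| < e -> F y != 0.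
Proof.
move=> Fx d0 [Fd FD].
have : (fun h => h^-1 *: ((F \o shift x) (h *: 1) - F x)) @ 0^' --> d by rewrite -FD.
(* A second zero would make the difference quotient 0, at distance exactly |d| from its limit. *)
move=> /cvgrPdist_lt /(_ `|d|); rewrite normr_gt0 => /(_ d0) [e /= e0 He].
exists e => // y yx yxe; apply/eqP => Fy.
have := He (y - x); rewrite /= sub0r normrN subr_eq0 => /(_ yxe yx).
by rewrite /= [_ *: 1]mulr1 subrK Fy Fx subrr scaler0 subr0 ltxx.
Qed.

(** The balls of half the isolation radius around the points of Z are pairwise disjoint, and the
    line is separable. *)
Lemma countable_isolated (Z : set R) :
  (forall x, Z x -> exists2 e : R, 0 < e & forall y, y != x -> `|y - x| < e -> ~ Z y) ->
  countable Z.
Proof.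
move=> iso.
have /choice[e eP] : forall x, exists e : R, 0 < e /\
    (Z x -> forall y, y != x -> `|y - x| < e -> ~ Z y).
  move=> x; have [/iso[e e0 eP]|nZ] := pselect (Z x); first by exists e.
  by exists 1; split=> // /nZ.
apply: (@separated_open_countable R R (fun x => ball x (e x / 2)) Z).
- by move=> x; exact: ball_open.
- by move=> x; exists x; apply: ballxx; rewrite divr_gt0// (eP x).1.
move=> x y Zx Zy [t []]; rewrite /ball /= => xt yt.
apply/eqP; apply: contrapT => /negP xy.
have xyd : `|x - y| < e x / 2 + e y / 2.
  rewrite (_ : x - y = (x - t) - (y - t)); last by rewrite opprB addrA subrK.
  by apply: le_lt_trans (ler_normB _ _) (ltrD xt yt).
have [exy|eyx] := leP (e x) (e y).
- by apply: ((eP y).2 Zy x) => //; lra.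
- by apply: ((eP x).2 Zx y) => //; rewrite 1?eq_sym// distrC; lra.
Qed.

(** [z] is frozen at i, that is lambda = 1; a general real lambda = t enters through the scaling x =
    t l. *)
Definition phase_fun (c : R[i]) x : R := complex.Re (c * S2 'i%C x).

Lemma is_derive_phase_fun c x :
  is_derive x 1 (phase_fun c) (complex.Re (c * S1 'i%C x)).
Proof. by have [] := cderZ c (cder_s2_quot 'i%C x). Qed.

(** If c S1 and c S2 were both purely imaginary, then S1 conj(S2) = c S1 conj(c S2) would be
    real. *)
Lemma phase_fun_simple c x : normc c = 1 -> x != 0 -> phase_fun c x = 0 ->
  complex.Re (c * S1 'i%C x) != 0.
Proof.
move=> c1 x0 F0; apply/eqP => F1; have /eqP := phase_derivative_neq0 x0; apply.
have cc : c * conjc c = 1.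
  by apply: cplxP; rewrite ?ReMJ ?ImMJ ?c1 ?expr1n.
have -> : S1 'i%C x * conjc (S2 'i%C x) = (c * S1 'i%C x) * conjc (c * S2 'i%C x).
  transitivity ((c * conjc c) * (S1 'i%C x * conjc (S2 'i%C x))).
    by rewrite cc mul1r.
  by rewrite (conjcM c); ring.
by rewrite ImM ImJ ReJ F1 (F0 : complex.Re (c * S2 'i%C x) = 0) mul0r mulr0 addr0.
Qed.

Lemma s2_quot_i x : S2 'i%C x = - s 2 ('i%C * x%:C).
Proof.
rewrite /s2_quot eq_complex /= oner_eq0 andbF sqr_i.
by rewrite invrN invr1 mulrN1.
Qed.

(** With q = s_2(i t l), conjugation symmetry turns the bracket in [Delta] into c^2 q + conj(q).
    Since c conj(c) = 1, this is c (c q + conj(c q)) = 2 c Re(c q). *)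
Lemma zeros_phase l theta (c : R[i]) (t : R) : c ^+ 2 = theta -> normc c = 1 ->
  t != 0 -> (Delta l theta t%:C = 0) <-> (phase_fun c (t * l) = 0).
Proof.
move=> c2 c1 t0.
have cc : c * conjc c = 1.
  by apply: cplxP; rewrite ?ReMJ ?ImMJ ?c1 ?expr1n.
have c0 : c != 0 by apply: contra_eq_neq cc => ->; rewrite mul0r eq_sym oner_eq0.
have i0 : ('i%C : R[i]) != 0 by rewrite eq_complex /= oner_eq0 andbF.
have tC0 : t%:C != 0 :> R[i] by rewrite eq_complex /= eqxx andbT.
pose q := s 2 ('i%C * (t * l)%:C).
have E : theta * s 2 ('i%C * t%:C * l%:C) + s 2 (- ('i%C * t%:C * l%:C))
    = c * ((2 * complex.Re (c * q))%:C).
  have -> : 'i%C * t%:C * l%:C = 'i%C * (t * l)%:C by rewrite rmorphM /= mulrA.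
  have -> : - ('i%C * (t * l)%:C) = conjc ('i%C * (t * l)%:C).
    by apply: cplxP => /=; ring.
  rewrite s2_conj -/q -c2.
  have -> : (2 * complex.Re (c * q))%:C = c * q + conjc (c * q).
    by apply: cplxP; rewrite !ReImE /=; ring.
  rewrite (conjcM c) mulrDr (mulrA c (conjc c)) cc mul1r; ring.
have FE : phase_fun c (t * l) = - complex.Re (c * q).
  by rewrite /phase_fun s2_quot_i -/q mulrN ReN.
rewrite /Delta (negPf tC0) E FE; split.
- move/eqP; rewrite oppr_eq0 !mulf_eq0 invr_eq0 expf_eq0 /= mulf_eq0.
  rewrite (negPf i0) (negPf tC0) (negPf c0) /= => /eqP /(congr1 (@complex.Re R)) /=.
  by lra.
- move=> /eqP; rewrite oppr_eq0 => /eqP ->.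
  by rewrite mulr0 mulr0 mulr0 oppr0.
Qed.

Lemma ex_unit_sqrt theta : normc theta = 1 ->
  exists2 c : R[i], c ^+ 2 = theta & normc c = 1.
Proof.
move=> t1; exists (sqrtc theta); first exact: sqr_sqrtc.
apply/eqP; rewrite -(@pexpr_eq1 _ _ 2)// ?normc_ge0//.
by rewrite expr2 -normcM -expr2 sqr_sqrtc t1.
Qed.

Lemma real_zeros_countable l theta : 0 < l -> normc theta = 1 ->
  countable (real_zeros l theta).
Proof.
move=> l0 /ex_unit_sqrt[c c2 c1].
have Zc : countable [set x : R | x != 0 /\ phase_fun c x = 0].
  apply: countable_isolated => x [x0 Fx].
  have [e e0 eP] :=
    isolated_zero Fx (phase_fun_simple c1 x0 Fx) (is_derive_phase_fun c x).
  by exists e => // y yx ye [_ /eqP]; apply/negP; exact: eP.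
(* The point 0, where [zeros_phase] does not apply, is put in as a set of its own. *)
pose Z n : set R := if n is 0 then [set 0] else
  (fun x => x / l) @` [set x : R | x != 0 /\ phase_fun c x = 0].
apply: (@sub_countable _ _ _ (\bigcup_n Z n)); last first.
  apply: bigcup_countable => // -[|n] _; first exact: countable1.
  exact: (card_le_trans (card_image_le _ _) Zc).
apply: subset_card_le => t Zt; have [->|t0] := eqVneq t 0; first by exists 0%N.
have l_neq0 : l != 0 by rewrite gt_eqF.
exists 1%N => //; exists (t * l); last by rewrite /= mulfK.
by split; [rewrite mulf_neq0|exact: (zeros_phase l c2 c1 t0).1].
Qed.

(** * Existence of infinitely many real zeros *)

Lemma is_derive_continuousT (F F' : R -> R) :
  (forall x, is_derive x 1 F (F' x)) -> continuous F.
Proof. by move=> Fd x; exact: is_derive_continuous. Qed.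

(** Each interval [a n, a n.+1] contains a zero, and it is interior because F does not vanish at the
    nodes; disjointness gives injectivity. The factor w only sets the sign at which the alternation
    starts. *)
Lemma alternating_zeros (F : R -> R) (w : R) (a : nat -> R) : continuous F ->
  (forall n, a n < a n.+1) -> (forall n, 0 < (-1) ^+ n * w * F (a n)) ->
  exists f : nat -> R, injective f /\ forall n, a n <= f n /\ F (f n) = 0.
Proof.
move=> Fc a_lt a_pos.
have /choice[f fP] : forall n, exists x, a n < x < a n.+1 /\ F x = 0.
  move=> n; have [||x xab Fx] := @IVT R F (a n) (a n.+1) 0 (ltW (a_lt n)).
  - exact: continuous_subspaceT.
  - have := a_pos n; have := a_pos n.+1; rewrite exprS mulN1r !mulNr.
    set u := F (a n); set v := F (a n.+1); set s := (-1) ^+ n * w => sv su.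
    have [s0|s0|s0] := ltgtP s 0; last by rewrite s0 mul0r ltxx in su.
      rewrite ge_min le_max; move: su sv; rewrite (nmulr_rgt0 _ s0) oppr_gt0 => u0.
      by rewrite (nmulr_rlt0 _ s0) => v0; rewrite (ltW u0) (ltW v0) orbT.
    rewrite ge_min le_max; move: su sv; rewrite (pmulr_rgt0 _ s0) oppr_gt0 => u0.
    by rewrite (pmulr_rlt0 _ s0) => v0; rewrite (ltW u0) (ltW v0) orbT.
  exists x; split=> //; move: xab; rewrite in_itv/= => /andP[ax xb].
  have nz m : F (a m) != 0.
    by apply/eqP => Fm; have := a_pos m; rewrite Fm mulr0 ltxx.
  rewrite !lt_neqAle ax xb !andbT; apply/andP; split.
    by apply: contraNneq (nz n) => ->; rewrite Fx.
  by apply: contraNneq (nz n.+1) => <-; rewrite Fx.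
exists f; split; last first.
  by move=> n; have [/andP[/ltW an _] Fn] := fP n.
have f_lt : {homo f : m n / (m < n)%N >-> m < n}.
  apply: homo_ltn; first exact: lt_trans.
  move=> n; have [/andP[_ fn] _] := fP n; have [/andP[fn1 _] _] := fP n.+1.
  exact: lt_trans fn fn1.
move=> m n fmn; apply/eqP; case: ltngtP => // /f_lt; by rewrite fmn ltxx.
Qed.

Lemma normc_expC (z : R[i]) : normc (expC z) = expR (complex.Re z).
Proof.
rewrite /expC normcM /= !expr0n /= addr0 cos2Dsin2 sqrtr1 mulr1 sqrtr_sqr.
by rewrite ger0_norm// expR_ge0.
Qed.

Lemma cosD_pin (g : R) n : cos (g + pi *+ n) = (-1) ^+ n * cos g.
Proof.
elim: n => [|n IH]; first by rewrite addr0 mul1r.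
by rewrite mulrSr addrA cosDpi IH exprS mulN1r mulNr.
Qed.

Lemma sinD_pin (g : R) n : sin (g + pi *+ n) = (-1) ^+ n * sin g.
Proof.
elim: n => [|n IH]; first by rewrite addr0 mul1r.
by rewrite mulrSr addrA sinDpi IH exprS mulN1r mulNr.
Qed.

(** The exponentials for the roots 1 and [zeta2] have modulus at most 1 when x >= 0, which gives the
    bound 2. The dominant term appears with a plus sign because S2 divides s_2 by i^2 = -1. *)
Lemma phase_fun_asymptotic (c : R[i]) x : normc c = 1 -> 0 <= x ->
  `|3 * phase_fun c x + expR (Num.sqrt 3 / 2 * x)
      * (complex.Re (c * zeta3 R) * cos (x / 2)
         + complex.Im (c * zeta3 R) * sin (x / 2))| <= 2.
Proof.
move=> c1 x0; set d := c * zeta3 R.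
have z21 : normc (zeta2 R) = 1.
  apply/eqP; rewrite -(@pexpr_eq1 _ _ 2)// ?normc_ge0// normc_sqr zeta2E /=.
  by rewrite !expr_div_n sqrrN expr1n sqr_sqrtr//; apply/eqP; field.
pose u := c * expC ('i%C * x%:C).
pose v := c * (zeta2 R * expC ('i%C * x%:C * zeta2 R)).
pose w := c * (zeta3 R * expC ('i%C * x%:C * zeta3 R)).
have e2 : 'i%C * x%:C * zeta2 R = (- (Num.sqrt 3 / 2 * x)) +i* (- (x / 2)).
  by rewrite zeta2E; apply: cplxP => /=; field.
have e3 : 'i%C * x%:C * zeta3 R = (Num.sqrt 3 / 2 * x) +i* (- (x / 2)).
  by rewrite zeta3E zeta2E; apply: cplxP => /=; field.
have wE : complex.Re w = expR (Num.sqrt 3 / 2 * x)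
    * (complex.Re d * cos (x / 2) + complex.Im d * sin (x / 2)).
  rewrite /w mulrA -/d e3 /expC [complex.Re (_ +i* _)]/= [complex.Im (_ +i* _)]/=.
  by rewrite cosN sinN !ReImE [complex.Re _%:C]/= [complex.Im _%:C]/= /=; ring.
have S2E : c * S2 'i%C x = - 3^-1 * (u + v + w).
  by rewrite s2_quot_i s2E /u /v /w; ring.
have FE : 3 * phase_fun c x = - (complex.Re u + complex.Re v + complex.Re w).
  rewrite /phase_fun S2E.
  have -> : - 3^-1 = (- 3^-1)%:C :> R[i].
    by rewrite rmorphN fmorphV rmorph_nat.
  by rewrite ReM !ReD /= mul0r subr0; field.
rewrite FE -wE opprD addrNK normrN.
have u1 : normc u <= 1.
  by rewrite /u (normcM c) c1 mul1r normc_expC /= !(mul0r, mul1r) subr0 expR0.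
have v1 : normc v <= 1.
  rewrite /v (normcM c) (normcM (zeta2 R)) c1 z21 !mul1r e2.
  rewrite normc_expC -[leRHS]expR0 ler_expR /= oppr_le0.
  by rewrite mulr_ge0// divr_ge0// sqrtr_ge0.
apply: le_trans (ler_normD _ _) _; rewrite -[leRHS]/(1 + 1) lerD//.
- exact: le_trans (Re_le_normc u) u1.
- exact: le_trans (Re_le_normc v) v1.
Qed.

Lemma phase_fun_infinite (c : R[i]) : normc c = 1 ->
  exists f : nat -> R, injective f /\ forall n, 0 < f n /\ phase_fun c (f n) = 0.
Proof.
move=> c1; pose d := c * zeta3 R; pose p := complex.Re d; pose q := complex.Im d.
have z31 : normc (zeta3 R) = 1.
  apply/eqP; rewrite -(@pexpr_eq1 _ _ 2)// ?normc_ge0// normc_sqr zeta3E zeta2E /=.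
  by rewrite sqrrN !expr_div_n sqrrN expr1n sqr_sqrtr//; apply/eqP; field.
have pq : p ^+ 2 + q ^+ 2 = 1.
  by rewrite -normc_sqr /d (normcM c) c1 z31 mulr1 expr1n.
(* The candidates g = 0 and g = pi / 2 give p and q; as p^2 + q^2 = 1, one of the squares reaches
   1/4. *)
have [g [g0 gW]] : exists g : R, 0 <= g /\ 1 / 4 <= (p * cos g + q * sin g) ^+ 2.
  have [p4|p4] := leP (1 / 4) (p ^+ 2).
    by exists 0; rewrite cos0 sin0 mulr1 mulr0 addr0; split.
  exists (pi / 2); rewrite cos_pihalf sin_pihalf mulr0 mulr1 add0r; split; last by lra.
  by rewrite divr_ge0// pi_ge0.
pose W := p * cos g + q * sin g.
(* At these nodes the trigonometric factor is (-1)^n W. The shift by 2 is even, so it keeps the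
   sign, and it makes a n >= 8. *)
pose a n : R := 2 * (g + pi *+ n.+2).
have a_lt n : a n < a n.+1.
  by rewrite /a ltr_pM2l// ltrD2l [ltRHS]mulrSr ltrDl pi_gt0.
have a_ge n : 8 <= a n.
  have -> : a n = 2 * (g + (pi + (pi + pi *+ n))) by rewrite /a !mulrS.
  have := mulrn_wge0 n (@pi_ge0 R); have := @pi_ge2 R; lra.
have r3 : 1 <= Num.sqrt 3 :> R by rewrite -[leLHS]sqrtr1 ler_wsqrtr// ler1n.
have Fc : continuous (phase_fun c).
  exact: is_derive_continuousT (is_derive_phase_fun c).
have sign n : 0 < (-1) ^+ n * (- W) * phase_fun c (a n).
  have an0 : 0 <= a n by apply: le_trans (a_ge n); rewrite ler0n.
  have := phase_fun_asymptotic c1 an0; rewrite -/d -/p -/q.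
  have -> : a n / 2 = g + pi *+ n.+2 by rewrite /a mulrC mulKf.
  rewrite cosD_pin sinD_pin !exprS !mulN1r opprK.
  set F := phase_fun c (a n); set E := expR _; set sg := (-1) ^+ n.
  have sg2 : sg * sg = 1 by rewrite -expr2 sqrr_sign.
  (* With |W| >= 1/2 the dominant term is at least 5/2, which exceeds the error 2. The estimate is
     e^y >= 1 + y at some y >= 4. *)
  have E5 : 5 <= E.
    apply: le_trans (expR_ge1Dx _); have := a_ge n; nra.
  pose A := sg * W; have A2 : 1 / 4 <= A * A.
    have -> : A * A = W ^+ 2.
      by transitivity (sg * sg * (W ^+ 2)); [rewrite /A; ring|rewrite sg2 mul1r].
    exact: gW.
  have -> : p * (sg * cos g) + q * (sg * sin g) = A by rewrite /A /W; ring.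
  have -> : sg * - W * F = - (A * F) by rewrite /A; ring.
  rewrite ler_norml oppr_gt0 => /andP[h1 h2].
  have [A0|A0] := leP 0 A.
    have A12 : 1 / 2 <= A by nra.
    have F0 : F < 0 by nra.
    by rewrite pmulr_rlt0//; lra.
  have A12 : A <= - (1 / 2) by nra.
  have F0 : 0 < F by nra.
  by rewrite pmulr_llt0.
have [f [f_inj fP]] := alternating_zeros Fc a_lt sign.
exists f; split=> // n; have [an Fn] := fP n; split=> //.
by apply: lt_le_trans an; apply: lt_le_trans (a_ge n); rewrite ltr0n.
Qed.

Lemma real_zeros_infinite l theta : 0 < l -> normc theta = 1 ->
  infinite_set (real_zeros l theta).
Proof.
move=> l0 /ex_unit_sqrt[c c2 c1]; have l_neq0 : l != 0 by rewrite gt_eqF.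
have [f [f_inj fP]] := phase_fun_infinite c1.
apply/infiniteP/pcard_leP/injfunPex; exists (fun n => f n / l).
  move=> n _ /=; have [fn0 Fn] := fP n.
  apply: (zeros_phase l c2 c1 _).2; last by rewrite divfK.
  by rewrite mulf_neq0 ?invr_eq0// gt_eqF.
move=> m n _ _ /(mulIf _) mn; apply: f_inj; apply: mn.
by rewrite invr_eq0.
Qed.

Lemma real_zeros_enumeration l theta : 0 < l -> normc theta = 1 ->
  exists lam : int -> R, enumerates lam (real_zeros l theta).
Proof.
move=> l0 th1; pose Z := real_zeros l theta.
have : ([set: int] #= Z)%card.
  rewrite card_eq_le; apply/andP; split.
    apply: card_le_trans (countableP [set: int]) _.
    exact/infiniteP/real_zeros_infinite.
  apply: card_le_trans (real_zeros_countable l0 th1) _.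
  have : (Posz @` [set: nat] #= [set: nat])%card.
    by apply: inj_card_eq => m n _ _ [].
  rewrite card_eq_le => /andP[_ natZ]; apply: card_le_trans natZ _.
  exact: subset_card_le.
move=> /card_set_bijP[lam [lamZ lam_inj lam_surj]].
exists lam; split; first by move=> m n; apply: lam_inj; rewrite inE.
by apply/seteqP; split=> [_ [n _ <-]|t /lam_surj//]; exact: lamZ.
Qed.

End RealZeros.

(** * The spectrum *)

Section Spectrum.
Variable R : realType.
Implicit Types (l t x : R) (theta lambda : R[i]).
Local Notation normc := Normc.normc.
Local Notation S0 := s0_quot.
Local Notation S1 := s1_quot.
Local Notation S2 := s2_quot.

Lemma regular_of_Delta_neq0 l theta lambda : 0 <= l -> Delta l theta lambda != 0 ->
  regular_point l (L0 l theta) (lambda ^+ 3).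
Proof.
move=> l0 D0; have [C [C0 CP]] := resolvent_bound l0 D0; split.
- move=> y h yh hy; have [_ fL yB] := CP y h yh.
  have f0 : ae_eq_on l (fun x => h x - lambda ^+ 3 * y x) (fun=> 0).
    have [N [mN N0 subN]] := hy; exists N; split=> // x nx; apply: subN => /= fx.
    by apply: nx => xl; rewrite fx// subrr.
  apply: ae_eq_onW => x /andP[/ltW x0 /ltW xl]; apply: Normc.eq0_normc.
  apply/eqP; rewrite eq_le normc_ge0 andbT.
  by have := yB x; rewrite x0 xl L2norm_ae0// mulr0; apply.
- by move=> f; exact: resolvent_surjective.
- exists ((l + 1) * C) => y h yh; have [yL fL yB] := CP y h yh.
  by rewrite -mulrA; apply: L2norm_le_sup => //; rewrite mulr_ge0// L2norm_ge0.
Qed.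

Lemma ccont_psi_num l lambda (k : R[i]) : ccont (fun x => k * psi_num l lambda x).
Proof.
set z := 'i%C * lambda.
apply: (@cder_cont _ _ (fun x => k * (S1 z x * S1 z l + - S2 z l * S0 z x))) => x.
apply: (cder_ext (cderZ k (cderD (cderZ (S1 z l) (cder_s2_quot z x))
  (cderZ (- S2 z l) (cder_s1_quot z x))))) => [t|].
  by rewrite /psi_num -/z; ring.
by ring.
Qed.

(** The coefficient of S1 in [psi_num] is - S2(l), nonzero for real t by [s2_quot_neq0]. *)
Lemma psi_num_neq0 l t (k : R[i]) : 0 < l -> k != 0 ->
  ~ (forall x, 0 < x < l -> k * psi_num l t%:C x = 0).
Proof.
move=> l0 k0 H; set z := 'i%C * t%:C in H.
have [|/eqP] := @fund_free R z (- S2 z l) (S1 z l) 0 l l0; last first.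
  by rewrite oppr_eq0 (negPf (s2_quot_neq0 t l0)).
move=> x /H /eqP; rewrite mulf_eq0 (negPf k0) /= => /eqP <-.
by rewrite /psi_num -/z; ring.
Qed.

(** [psi_num] vanishes at 0 and at l for every lambda; the defect y'(l) - theta y'(0) is k times
    [bvp_det]. *)
Lemma psi_num_L0 l theta t (k : R[i]) : 0 <= l -> Delta l theta t%:C = 0 ->
  L0 l theta (fun x => k * psi_num l t%:C x)
    (fun x => t%:C ^+ 3 * (k * psi_num l t%:C x)).
Proof.
move=> l0; rewrite Delta_det => /eqP; rewrite oppr_eq0 => /eqP D0.
set z := 'i%C * t%:C in D0 *.
have E x : k * psi_num l t%:C x = (- k * S2 z l) * S1 z x + (k * S1 z l) * S2 z x.
  by rewrite /psi_num -/z; ring.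
rewrite (_ : (fun x => k * psi_num l t%:C x) =
  (fun x => (- k * S2 z l) * S1 z x + (k * S1 z l) * S2 z x)); last exact/funext.
rewrite (_ : (fun x => t%:C ^+ 3 * (k * psi_num l t%:C x)) =
  (fun x => t%:C ^+ 3 * ((- k * S2 z l) * S1 z x + (k * S1 z l) * S2 z x))); last first.
  by apply/funext => x; rewrite E.
apply: homogeneous_L0 => //; rewrite -/z; first by ring.
apply/eqP; rewrite -subr_eq0.
rewrite (_ : _ - _ = k * bvp_det l theta z); last by rewrite /bvp_det; ring.
by rewrite D0 mulr0.
Qed.

Lemma norming_const_gt0 l t : 0 < l -> 0 < norming_const l (t%:C : R[i]).
Proof.
move=> l0; rewrite /norming_const lt_neqAle L2norm_ge0 andbT eq_sym.
apply/eqP => N0; apply: (@psi_num_neq0 l t 1 l0); first exact: oner_neq0.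
apply: L2norm0_continuous; first exact: ccont_psi_num.
by rewrite -[RHS]N0; apply: L2norm_eq => x; rewrite mul1r.
Qed.

Lemma psi_num_L2 l lambda : L2 l (psi_num l lambda).
Proof.
apply: L2_eq (L2_cwithin (ccont_within l (ccont_psi_num l lambda 1))) => x _.
by rewrite mul1r.
Qed.

Lemma normalizingP l t a : 0 < l ->
  normalizing l t%:C a <-> a = norming_const l (t%:C : R[i]).
Proof.
move=> l0; have N0 := norming_const_gt0 t l0.
have E b : 0 < b -> L2norm l (psi_with l b t%:C) = b^-1 * norming_const l (t%:C : R[i]).
  move=> b0; rewrite (L2normZ _ (psi_num_L2 l t%:C)); congr (_ * _).
  rewrite Normc.normcV /= expr0n /= addr0 sqrtr_sqr ger0_norm//; exact: ltW.
split=> [[a0]|->].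
  rewrite E// => /(congr1 (fun u => a * u)).
  by rewrite mulVKf ?gt_eqF// mulr1.
by split=> //; rewrite E// mulVf// gt_eqF.
Qed.

Lemma psi_eigenfunction l theta t (k : R[i]) : 0 < l -> k != 0 ->
  Delta l theta t%:C = 0 ->
  eigenfunction l (L0 l theta) (t%:C ^+ 3) (fun x => k * psi_num l t%:C x).
Proof.
move=> l0 k0 D0; split.
  move=> y0; apply: (psi_num_neq0 (t := t) l0 k0).
  apply: L2norm0_continuous; first exact: ccont_psi_num.
  by apply: L2norm_ae0 => //; apply/L2Z/psi_num_L2.
exists (fun x => t%:C ^+ 3 * (k * psi_num l t%:C x)); split; last exact: ae_eq_onW.
exact: psi_num_L0 (ltW l0) D0.
Qed.

(** With zero right-hand side, u = y1(0) S1 + c S2. Because S2(l) is nonzero for real t, the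
    condition u(l) = 0 determines c from y1(0), so u is a multiple of [psi_num]. *)
Lemma eigenfunction_multiple l theta t u : 0 < l ->
  eigenfunction l (L0 l theta) (t%:C ^+ 3) u ->
  exists c : R[i], ae_eq_on l u (fun x => c * psi_num l t%:C x).
Proof.
move=> l0 [_ [h [[y1 [y2 [y3 [uW u0 y1l ul hE]]]] hu]]]; have l00 := ltW l0.
set z := 'i%C * t%:C.
have [C [_ /(_ _ _ _ _ uW u0) [P [Q [c [E PQ]]]]]] := solution_form z l00.
have gL := W23_rhs_L2 (z ^+ 3) l00 uW.
have g0 : L2norm l (fun x => y3 x - z ^+ 3 * u x) = 0.
  apply: L2norm_ae0 => //.
  have [N [mN N0 subN]] := hu; exists N; split=> // x nx; apply: subN => /= fx.
  apply: nx => /fx; rewrite hE => e; apply: Normc.eq0_normc.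
  by rewrite -normc_rhs e subrr Normc.normc0.
(* The right-hand side is 0 only almost everywhere; the estimate of [solution_form] with B = 0 still
   makes P vanish everywhere on [0, l]. *)
have P0 x : 0 <= x <= l -> P x = 0.
  move=> xl; have [|Px _] := PQ 0 _ x xl.
    by move=> s sl; have := normc_cint_le gL sl; rewrite g0 mulr0.
  by apply: Normc.eq0_normc; apply/eqP; rewrite eq_le normc_ge0 andbT -[leRHS](mulr0 C).
have S20 := s2_quot_neq0 t l0; rewrite -/z in S20.
have ll : 0 <= l <= l by apply/andP; split.
have [ulE _] := E l ll; rewrite ul P0// add0r in ulE.
have cE : c = - (S1 z l * y1 0) / S2 z l.
  apply: (mulfI S20); rewrite mulrCA mulfV// mulr1; apply/eqP.
  by rewrite -subr_eq0 opprK addrC -ulE.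
exists (- y1 0 / S2 z l); apply: ae_eq_onW => x /andP[/ltW x0 /ltW xl].
have xl' : 0 <= x <= l by rewrite x0.
by have [-> _] := E x xl'; rewrite P0// cE /psi_num -/z; field.
Qed.

(** * From complex to real cube roots *)

Lemma Delta_zeta l theta lambda : Delta l theta (lambda * zeta2 R) = Delta l theta lambda.
Proof.
rewrite !Delta_det /bvp_det mulrA s1_quot_zeta s2_quot_zeta.
rewrite /s0_quot (mulrAC ('i%C * lambda) (zeta2 R)) s0_zeta //.
Qed.

(** Equal cubes differ by a cube root of unity, and [Delta] is invariant under [zeta2]. *)
Lemma Delta_cube l theta lambda lambda' : lambda ^+ 3 = lambda' ^+ 3 ->
  Delta l theta lambda = Delta l theta lambda'.
Proof.
move=> e; set w := zeta2 R.
have : (lambda - lambda') * ((lambda - lambda' * w) * (lambda - lambda' * w * w)) = 0.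
  have w3 : w ^+ 3 = 1 by exact: zeta_exp3.
  have ws : 1 + w + w ^+ 2 = 0 by rewrite /w zeta_sqr zeta_sum.
  rewrite (_ : _ * _ = lambda ^+ 3 - w ^+ 3 * lambda' ^+ 3
    - lambda * lambda' * (lambda - w * lambda') * (1 + w + w ^+ 2)); last by ring.
  by rewrite w3 ws e mul1r mulr0 subr0 subrr.
move=> /eqP; rewrite !mulf_eq0 !subr_eq0 => /or3P[] /eqP -> //.
  by rewrite Delta_zeta.
by rewrite !Delta_zeta.
Qed.

Lemma real_cube_root (m : R) : exists t : R, t ^+ 3 = m.
Proof.
have nonneg (u : R) : 0 <= u -> exists t : R, t ^+ 3 = u.
  move=> u0; have r0 : 0 <= 3.-root (u%:C : R[i]) by rewrite rootC_ge0// ler0c.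
  have rE : 3.-root (u%:C : R[i]) = (complex.Re (3.-root (u%:C : R[i])))%:C.
    by move: (ger0_Im r0); case: (3.-root _) => a b /= ->.
  exists (complex.Re (3.-root (u%:C : R[i]))); apply: complexI.
  by rewrite rmorphXn /= -rE rootCK.
have [/nonneg//|m0] := leP 0 m.
have [|t tE] := nonneg (- m); first by rewrite oppr_ge0 ltW.
by exists (- t); rewrite exprNn tE; rewrite !exprS expr0; ring.
Qed.

Lemma spectrum_L0 l theta : 0 < l -> `|theta| = 1 ->
  spectrum l (L0 l theta) = [set t%:C ^+ 3 | t in real_zeros l theta].
Proof.
move=> l0 th1; apply/seteqP; split=> [mu nreg|_ [t t0 <-] [inj _ _]].
  (* This root need not be real. It serves to show that [Delta] vanishes and hence that mu is real;
     then it is exchanged for the real cube root. *)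
  pose lambda := 3.-root mu.
  have lE : lambda ^+ 3 = mu by rewrite /lambda rootCK.
  have D0 : Delta l theta lambda = 0.
    apply/eqP/negPn/negP => D0; apply: nreg; rewrite -lE.
    exact: regular_of_Delta_neq0 (ltW l0) D0.
  have [t tE] := real_cube_root (complex.Re mu).
  have tmu : t%:C ^+ 3 = mu.
    rewrite -rmorphXn /= tE; move: (zero_real l0 th1 D0); rewrite lE.
    by case: (mu) => a b /= ->.
  exists t => //; rewrite /real_zeros /= -D0; apply: Delta_cube.
  by rewrite tmu lE.
have [y0 [h [yh hy]]] := @psi_eigenfunction l theta t 1 l0 (oner_neq0 _) t0.
exact: y0 (inj _ _ yh hy).
Qed.

End Spectrum.

Theorem theorem1p2 (R : realType) (l : R) (theta : R[i])
    (l_gt0 : 0 < l) (theta_unit : `|theta| = 1) :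
  [/\ simple_spectrum l (L0 l theta),
      exists lam : int -> R, enumerates lam (real_zeros l theta),
      forall lam : int -> R, enumerates lam (real_zeros l theta) ->
        spectrum l (L0 l theta) = [set (lam n)%:C ^+ 3 | n in [set: int]] /\
        forall n : int,
          (forall a : R, normalizing l (lam n)%:C a <->
             a = norming_const l (lam n)%:C) /\
          eigenfunction l (L0 l theta) ((lam n)%:C ^+ 3) (psi l (lam n)%:C) &
      forall (lambda : R[i]) (x : R), 0 <= x <= l ->
        psi l (lambda * zeta2 R) x = psi l lambda x].
Proof.
split.
- move=> mu; rewrite spectrum_L0// => -[t t0 <-].
  exists (fun x => 1 * psi_num l t%:C x).
    exact: psi_eigenfunction (oner_neq0 _) t0.
  move=> u /(eigenfunction_multiple l_gt0)[c cP]; exists c.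
  by under [X in ae_eq_on _ _ X]eq_fun do rewrite mul1r.
- exact: real_zeros_enumeration (theta_normc theta_unit).
- move=> lam [lam_inj lam_range]; split.
    rewrite spectrum_L0// -lam_range; apply/seteqP; split.
      by move=> _ [_ [n _ <-] <-]; exists n.
    by move=> _ [n _ <-]; exists (lam n) => //; exists n.
  move=> n; split=> [a|]; first exact: normalizingP.
  apply: psi_eigenfunction => //.
    rewrite invr_eq0 eq_complex /= negb_and gt_eqF//; exact: norming_const_gt0.
  have : real_zeros l theta (lam n) by rewrite -lam_range; exists n.
  by [].
- by move=> lambda x _; exact: psi_zeta.
Qed.
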